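(* Fix $a<0<b$ and $q\in(0,1]$. The relation $R_{\mu}(x;q)=R_{w}(x;q)$ for all real $x\notin[a,b]$ defines a one-to-one correspondence $w\leftrightarrow\mu$ between $\mathcal{D}[a,b]$ and $\mathcal{M}[a,b]$. That is, for every $w\in\mathcal{D}[a,b]$ there is exactly one $\mu\in\mathcal{M}[a,b]$ with $R_\mu(\cdot;q)=R_w(\cdot;q)$, and for every $\mu\in\mathcal{M}[a,b]$ there is exactly one $w\in\mathcal{D}[a,b]$ with this property.
   Context: A continual diagram is a function $w:\mathbb{R}\to\mathbb{R}$ with $|w(s_1)-w(s_2)|\leq|s_1-s_2|$ for all $s_1,s_2$ such that there is $s_0\in\mathbb{R}$ with $w(s)=|s-s_0|$ for $|s|$ large. For fixed $a<0<b$, $\mathcal{D}[a,b]$ is the set of continual diagrams with $w(s)=|s-s_0|$ for all $s\notin[a,b]$, and $\mathcal{M}[a,b]$ is the set of probability measures on $[a,b]$. The charge of $w$ is $\sigma(s)=\frac12(w(s)-|s|)$. For $0<q<1$ and real $x\notin[a,b]$, $$R_w(x;q)=\frac{1-q}{1-q^x}\exp\Big[-\ln q^{-1}\int_a^b\frac{d\sigma(s)}{1-q^{x-s}}\Big],\qquad R_\mu(x;q)=(1-q)\int_a^b\frac{\mu(ds)}{1-q^{x-s}} .$$ For $q=1$, $$R_w(x;1)=\frac1x\exp\Big[-\int_a^b\frac{d\sigma(s)}{s-x}\Big],\qquad R_\mu(x;1)=\int_a^b\frac{\mu(ds)}{x-s}.$$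
   Formalization: The printed R_w makes the claim false (e.g. w=|s-s0|, s0≠0). Proved instead with kernel q^{x-s}/(1-q^{x-s}) in place of 1/(1-q^{x-s}) for q<1, with 1/(x-s) in place of 1/(s-x) for q=1, and with s0 required to lie in [a,b] in D[a,b]. *)

(* Defs.v *)
From HB Require Import structures.
From mathcomp Require Import all_boot all_order all_algebra.
From mathcomp Require Import all_classical all_reals all_analysis.
Import Order.TTheory GRing.Theory Num.Theory.
Import numFieldNormedType.Exports.
From mathcomp Require Import lra.

Set Implicit Arguments.
Unset Strict Implicit.
Unset Printing Implicit Defensive.

Local Open Scope classical_set_scope.
Local Open Scope ring_scope.

Record continual_diagram (R : realType) := ContinualDiagram {
  diagram_fun :> R -> R ;
  diagram_lipschitz :
    forall s1 s2, `|diagram_fun s1 - diagram_fun s2| <= `|s1 - s2| ;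
  diagram_at_infinity :
    exists s0 M, forall s, M < `|s| -> diagram_fun s = `|s - s0| }.

(* The center s0 is required to lie in [a, b], so that the charge is carried
   by [a, b]. Otherwise all the diagrams |s - s0| with s0 >= b would qualify,
   although their charges coincide on [a, b] and only there do they enter the
   transform Rdiagram. *)
Definition diagrams (R : realType) (a b : R) : set (continual_diagram R) :=
  [set w | exists s0, a <= s0 <= b /\
    forall s, ~~ (a <= s <= b) -> w s = `|s - s0|].

Definition prob_measures (R : realType) (a b : R)
    : set (probability (measurableTypeR R) R) :=
  [set mu : probability (measurableTypeR R) R | mu `[a, b]%classic = 1%E].

Definition diagram_charge (R : realType) (w : continual_diagram R) (s : R)
    : R :=
  2^-1 * (w s - `|s|).

Definition abs_diagram (R : realType) : continual_diagram R.
Proof.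
apply: (@ContinualDiagram R (fun s => `|s|)) => [s1 s2|].
  exact: ler_dist_dist.
by exists 0, 0 => s _; rewrite subr0.
Defined.

(* Nondecreasing because w is 1-Lipschitz; see diagram_chargeE. *)
Definition half_diagram (R : realType) (w : continual_diagram R) (s : R) : R :=
  2^-1 * (w s + s).

Section half_diagram_cumulative.
Variables (R : realType) (w : continual_diagram R).

Let half_diagram_nd : nondecreasing (half_diagram w).
Proof.
move=> s t st; rewrite /half_diagram ler_pM2l ?invr_gt0//.
have := diagram_lipschitz w s t.
by rewrite ler_norml ler0_norm ?subr_le0// => /andP[_]; lra.
Qed.

Let half_diagram_rc : right_continuous (half_diagram w).
Proof.
move=> x; apply: cvg_at_right_filter; apply: cvgM; first exact: cvg_cst.
apply: cvgD; last exact: cvg_id.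
apply/cvgrPdist_le => e e0; near=> t.
apply: le_trans (diagram_lipschitz w x t) _.
by near: t; have /cvgrPdist_le := @cvg_id _ (nbhs x); apply.
Unshelve. all: by end_near. Qed.

HB.instance Definition _ := isCumulative.Build R _ R (half_diagram w)
  half_diagram_nd half_diagram_rc.

End half_diagram_cumulative.

Lemma diagram_chargeE (R : realType) (w : continual_diagram R) (s : R) :
  diagram_charge w s = half_diagram w s - half_diagram (abs_diagram R) s.
Proof. by rewrite /diagram_charge /half_diagram /=; lra. Qed.

(* The Lebesgue-Stieltjes integral of f over D against d(diagram_charge w);
   diagram_chargeE writes the charge as a difference of two continuous
   nondecreasing functions. *)
Definition charge_integral (R : realType) (w : continual_diagram R)
    (D : set R) (f : R -> R) : R :=
  \int[lebesgue_stieltjes_measure (half_diagram w)]_(s in D) f s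
  - \int[lebesgue_stieltjes_measure (half_diagram (abs_diagram R))]_(s in D)
      f s.

(* The exponents are those for which a rectangular diagram with minima x_i and
   maxima y_j has the transform
     (1 - q) \prod_j (1 - q^(x - y_j)) / \prod_i (1 - q^(x - x_i))   if q < 1,
     \prod_j (x - y_j) / \prod_i (x - x_i)                           if q = 1.
   For q < 1, the kernel 1 / (1 - q^(x - s)) in place of
   q^(x - s) / (1 - q^(x - s)) would multiply this by q^(- s0), where s0 is the
   center of w: this makes no difference for a centered diagram, but for
   s0 <> 0 the limit 1 - q at x = +oo, common to all Rmeasure mu q, would be
   lost. For q = 1, the kernel is 1 / (x - s), the limit of
   ln q^-1 * q^(x - s) / (1 - q^(x - s)); with 1 / (s - x) the diagram
   |s - s0| would have the transform (x - s0) / x^2 instead of 1 / (x - s0). *)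
Definition Rdiagram (R : realType) (a b : R) (w : continual_diagram R)
    (q x : R) : R :=
  if q == 1 then
    x^-1 * expR (- charge_integral w `[a, b] (fun s => (x - s)^-1))
  else
    (1 - q) / (1 - q `^ x) *
    expR (- (ln q^-1 * charge_integral w `[a, b]
                         (fun s => q `^ (x - s) / (1 - q `^ (x - s))))).

Definition Rmeasure (R : realType) (a b : R)
    (mu : probability (measurableTypeR R) R) (q x : R) : R :=
  if q == 1 then \int[mu]_(s in `[a, b]) (x - s)^-1
  else (1 - q) * \int[mu]_(s in `[a, b]) (1 - q `^ (x - s))^-1.

Definition corresponds (R : realType) (a b q : R) (w : continual_diagram R)
    (mu : probability (measurableTypeR R) R) : Prop :=
  forall x, ~~ (a <= x <= b) -> Rmeasure a b mu q x = Rdiagram a b w q x.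

(* Main.v *)
(** Write [F s = (w s + s) / 2]. Both transforms are Cauchy transforms in the
    variable [phi x], where [phi = id] for [q = 1] and [phi s = q^(-s)] for
    [q < 1]: the equation becomes, for [x] outside [[a, b]],
      int 1 / (phi x - phi s) dmu(s)
        = 1 / (phi x - phi b) * exp (- int phi' s / (phi x - phi s) dF(s)).
    If [dF] is Lebesgue measure on a finite union of intervals, the right-hand
    side is a product of factors [(z - y) / (z - x)] with interlacing [x] and
    [y]; appending factors one at a time splits each fraction [1 / (z - x_i)]
    into a convex combination of two, so the product is the transform of a
    discrete probability measure. Conversely, for a discrete measure with
    positive weights the factors are split off one at a time, each [y] being a
    zero in the last gap. Both directions pass to general [w] and [mu] by
    discretising on a grid and taking limits along an ultrafilter on [nat],
    under which distribution functions and 1-Lipschitz functions converge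
    pointwise. Uniqueness holds because the transform determines all moments of
    [phi], and polynomials in [phi] converge boundedly to the indicator of
    [s <= t]. *)

Require Import Defs.
From HB Require Import structures.
From mathcomp Require Import all_boot all_order all_algebra.
From mathcomp Require Import all_classical all_reals all_analysis.
From mathcomp Require Import measurable_realfun ring lra.
Import Order.TTheory GRing.Theory Num.Theory.
Import numFieldNormedType.Exports.

Set Implicit Arguments.
Unset Strict Implicit.
Unset Printing Implicit Defensive.

Local Open Scope classical_set_scope.
Local Open Scope ring_scope.

(** * Products of interlacing fractions *)

(** In the charge, the part coming from [|s|] can be integrated in closed form: it turns the
    prefactor of [Rdiagram] into 1 / (phi x - phi b), up to a factor (1 - q) phi x that [Rmeasure]
    also carries when q < 1. What remains is the positive measure dF, of mass at most b - a on
    [a, b], so every grid error is a Lipschitz constant times the mesh, uniformly in [w] and in the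
    measure. This uniformity lets the mesh tend to zero while the diagram or the measure still
    varies along the ultrafilter. The finite identities have degenerate cases: poles may coincide
    for a general diagram, and weights may vanish for a general measure. Weak interlacing covers the
    former, a small uniform mass added to the measure the latter. For q < 1 the exponent is a Cauchy
    transform of dF minus a multiple of the unknown mass of dF. Uniqueness of [w] therefore recovers
    that mass beforehand, from x far to the left of a, where phi x is close to 0. *)

Lemma partial_fractions_interlacing (R : realFieldType) (x y : nat -> R)
    (n : nat) :
  (forall i, (i < n)%N -> x i <= y i <= x i.+1) ->
  exists2 p : nat -> R, (forall i, 0 <= p i) /\ \sum_(i < n.+1) p i = 1 &
    forall z, (forall i, (i <= n)%N -> z != x i) ->
      \sum_(i < n.+1) p i / (z - x i) =
      (z - x n)^-1 * \prod_(i < n) ((z - y i) / (z - x i)).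
Proof.
elim: n => [|n IHn] xy.
  exists (fun=> 1).
    by split=> [i|]; rewrite ?ler01// big_ord_recl big_ord0 addr0.
  by move=> z zx; rewrite big_ord_recl !big_ord0 addr0 mulr1 mul1r.
have [|p [p0 p1] pE] := IHn; first by move=> i ilt; apply: xy; exact: leqW.
have xle i : (i <= n)%N -> x i <= x n.
  have xS j : (j < n.+1)%N -> x j <= x j.+1.
    by move=> /xy/andP[]; exact: le_trans.
  suff H m : (m <= n)%N -> (i <= m)%N -> x i <= x m by exact: H.
  elim: m => [|m IHm] mn; first by rewrite leqn0 => /eqP->.
  rewrite leq_eqVlt => /predU1P[->//|im].
  by apply: le_trans (IHm (ltnW mn) im) _; apply: xS; exact: leqW.
have /andP[xny ynx] := xy n (leqnn _).
(* If [x i = x n.+1] then [y n] is this number too, and [0 / 0 = 0] moves the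
   whole mass of [x i] to [x n.+1]. *)
pose c i := (y n - x i) / (x n.+1 - x i).
have c01 i : (i <= n)%N -> 0 <= c i <= 1.
  move=> /xle xi; have [xE|xneq] := eqVneq (x n.+1) (x i).
    by rewrite /c xE subrr invr0 mulr0 lexx ler01.
  have xlt : x i < x n.+1.
    by rewrite lt_neqAle eq_sym xneq (le_trans xi)// (le_trans xny).
  rewrite divr_ge0 ?ler_pdivrMr ?subr_gt0// ?mul1r ?lerD2r ?ynx//.
    by rewrite subr_ge0 (le_trans xi).
  by rewrite subr_ge0 ltW.
(* By (z - y_n) / ((z - x_i) (z - x_{n+1})) = c_i / (z - x_i) + (1 - c_i) / (z - x_{n+1}), the share
   c_i of each weight stays in place and the rest accumulates at the new pole. *)
pose p' i := if (i <= n)%N then p i * c i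
             else \sum_(j < n.+1) p j * (1 - c j).
have p'E (i : 'I_n.+1) : p' i = p i * c i by rewrite /p' -ltnS ltn_ord.
have p'n : p' n.+1 = \sum_(j < n.+1) p j * (1 - c j) by rewrite /p' ltnn.
exists p'.
  split=> [i|].
    rewrite /p'; case: ifPn => [/c01/andP[ci _]|_]; first by rewrite mulr_ge0.
    apply: sumr_ge0 => j _; rewrite mulr_ge0// subr_ge0.
    by have /andP[] := c01 j (ltn_ord j).
  rewrite big_ord_recr /= p'n.
  under eq_bigr do rewrite p'E.
  by rewrite -big_split /= -[RHS]p1; apply: eq_bigr => i _; ring.
move=> z zx; rewrite big_ord_recr /= p'n mulr_suml.
under eq_bigr do rewrite p'E.
rewrite -big_split /=.
rewrite [RHS](_ : _ = (z - y n) / (z - x n.+1) *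
    ((z - x n)^-1 * \prod_(i < n) ((z - y i) / (z - x i)))); last first.
  by rewrite big_ord_recr /=; ring.
rewrite -pE => [|i ilt]; last by rewrite zx// leqW.
rewrite mulr_sumr; apply: eq_bigr => i _.
have zi : z - x i != 0 by rewrite subr_eq0 zx// ltnW.
have zn : z - x n.+1 != 0 by rewrite subr_eq0 zx.
have [xE|xneq] := eqVneq (x n.+1) (x i).
  have -> : c i = 0 by rewrite /c xE subrr invr0 mulr0.
  have -> : y n = x i.
    by apply/eqP; rewrite eq_le -{1}xE ynx (le_trans _ xny) ?xle// -ltnS.
  by rewrite -xE; field.
have xin : x n.+1 - x i != 0 by rewrite subr_eq0.
by rewrite /c; field; rewrite xin zi zn.
Qed.

(** Multiplying the sum by (x_{n+1} - y) (y - x_n) removes the two singularities at the ends of the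
    gap. The resulting [f] is continuous on the closed gap, with values p_n (x_{n+1} - x_n) > 0 and
    - p_{n+1} (x_{n+1} - x_n) < 0 at its ends. *)
Lemma zero_last_gap (R : realType) (x p : nat -> R) (n : nat) :
  (forall i, (i <= n)%N -> x i < x i.+1) ->
  (forall i, (i <= n.+1)%N -> 0 < p i) ->
  exists2 y, x n < y < x n.+1 & \sum_(i < n.+2) p i / (y - x i) = 0.
Proof.
move=> xS p0.
have xle i : (i <= n)%N -> x i <= x n.
  suff H m : (m <= n)%N -> (i <= m)%N -> x i <= x m by exact: H.
  elim: m => [|m IHm] mn; first by rewrite leqn0 => /eqP->.
  rewrite leq_eqVlt => /predU1P[->//|im].
  by apply: le_trans (IHm (ltnW mn) im) _; apply/ltW/xS; exact: ltnW.
have xn := xS n (leqnn n).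
have xlt (i : 'I_n) : x i < x n.
  by apply: lt_le_trans (xS i _) (xle i.+1 _); rewrite // ltnW.
pose f y := \sum_(i < n) p i * (x n.+1 - y) * (y - x n) / (y - x i) +
  (p n * (x n.+1 - y) - p n.+1 * (y - x n)).
have fc : {within `[x n, x n.+1], continuous f}.
  apply: continuous_in_subspaceT => y; rewrite inE /= in_itv/= => /andP[xy _].
  apply: cvgD; last first.
    by apply: cvgB; apply: cvgM; try exact: cvg_cst;
      apply: cvgB; (exact: cvg_cst || exact: cvg_id).
  apply: cvg_big => [|i _]; first exact: add_continuous.
  apply: cvgM; first apply: cvgM; first apply: cvgM; first exact: cvg_cst.
  - by apply: cvgB; (exact: cvg_cst || exact: cvg_id).
  - by apply: cvgB; (exact: cvg_cst || exact: cvg_id).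
  apply: cvgV; first by rewrite subr_eq0 gt_eqF// (lt_le_trans (xlt i)).
  by apply: cvgB; (exact: cvg_cst || exact: cvg_id).
have fn : 0 < f (x n).
  rewrite /f big1 => [|i _]; last by rewrite subrr mulr0 mul0r.
  by rewrite add0r subrr mulr0 subr0 mulr_gt0 ?subr_gt0// p0// leqW.
have fn1 : f (x n.+1) < 0.
  rewrite /f big1 => [|i _]; last by rewrite subrr mulr0 !mul0r.
  by rewrite add0r subrr mulr0 sub0r oppr_lt0 mulr_gt0 ?subr_gt0// p0.
have [|y] := IVT (ltW xn) fc (v := 0).
  by rewrite ge_min le_max (ltW fn) (ltW fn1) orbT.
rewrite in_itv/= => /andP[xny ynx] fy.
have {}xny : x n < y.
  by rewrite lt_neqAle xny andbT; apply: contraTneq fn => ->; rewrite fy ltxx.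
have {}ynx : y < x n.+1.
  by rewrite lt_neqAle ynx andbT; apply: contraTneq fn1 => <-; rewrite fy ltxx.
exists y; first by rewrite xny.
have c0 : (x n.+1 - y) * (y - x n) != 0.
  by rewrite mulf_neq0// subr_eq0 gt_eqF.
apply: (mulfI c0); rewrite mulr0; apply: etrans _ fy.
rewrite /f !big_ord_recr /= -addrA mulrDr.
congr (_ + _).
  by rewrite mulr_sumr; apply: eq_bigr => i _; ring.
have yn : y - x n != 0 by rewrite subr_eq0 gt_eqF.
have yn1 : y - x n.+1 != 0 by rewrite subr_eq0 lt_eqF.
by field; rewrite yn yn1.
Qed.

(** Dividing the sum by (z - y) / (z - x_{n+1}), where y is its zero in the last gap, removes the
    pole x_{n+1} and creates none at y. The last gap is the right choice because y then exceeds all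
    remaining poles, which keeps the new weights positive. *)
Lemma factor_positive_fractions (R : realType) (x p : nat -> R) (n : nat) :
  (forall i, (i < n)%N -> x i < x i.+1) ->
  (forall i, (i <= n)%N -> 0 < p i) ->
  exists2 y : nat -> R, (forall i, (i < n)%N -> x i <= y i <= x i.+1) &
    forall z, (forall i, (i <= n)%N -> z != x i) ->
      \sum_(i < n.+1) p i / (z - x i) =
      (\sum_(i < n.+1) p i) *
      ((z - x n)^-1 * \prod_(i < n) ((z - y i) / (z - x i))).
Proof.
elim: n p => [|n IHn] p xS p0.
  exists x => // z zx.
  by rewrite !big_ord_recl !big_ord0 !addr0 mulr1.
have [y /andP[xny ynx] yE] := zero_last_gap xS p0.
have xlt i : (i <= n)%N -> x i < y.
  suff H m : (m <= n)%N -> (i <= m)%N -> x i <= x m.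
    by move=> il; apply: le_lt_trans (H n _ il) xny.
  elim: m => [|m IHm] mn; first by rewrite leqn0 => /eqP->.
  rewrite leq_eqVlt => /predU1P[->//|im].
  by apply: le_trans (IHm (ltnW mn) im) _; apply/ltW/xS; exact: leqW.
(* The residue at [x i] of the sum times (z - x_{n+1}) / (z - y). The total weight is preserved
   because p'_i - p_i = (x_{n+1} - y) p_i / (y - x_i), and these terms add up to 0 by the choice of
   y. *)
pose p' i := p i * ((x n.+1 - x i) / (y - x i)).
have [| |y' xy' y'E] := IHn p'.
- by move=> i ilt; apply: xS; exact: leqW.
- move=> i ilt; rewrite mulr_gt0 ?p0 ?leqW// divr_gt0 ?subr_gt0 ?xlt//.
  by rewrite (lt_trans (xlt _ ilt)).
have p'E : \sum_(i < n.+1) p' i = \sum_(i < n.+2) p i.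
  transitivity (\sum_(i < n.+2) (p i + (x n.+1 - y) * (p i / (y - x i)))).
    rewrite [RHS]big_ord_recr /=; rewrite [X in _ = _ + X](_ : _ = 0) ?addr0.
      apply: eq_bigr => i _; rewrite /p'.
      have yi : y - x i != 0 by rewrite subr_eq0 gt_eqF// xlt// -ltnS.
      by field.
    have yn : y - x n.+1 != 0 by rewrite subr_eq0 lt_eqF.
    by field.
  by rewrite big_split /= -mulr_sumr yE mulr0 addr0.
exists (fun i => if i == n then y else y' i).
  move=> i; rewrite ltnS leq_eqVlt => /predU1P[->|ilt].
    by rewrite eqxx !ltW.
  by rewrite (ltn_eqF ilt) xy'.
move=> z zx.
rewrite [X in _ = _ * (_ * X)]big_ord_recr /= eqxx.
rewrite [X in _ = _ * (_ * (X * _))](_ : _ =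
    \prod_(i < n) ((z - y' i) / (z - x i))); last first.
  by apply: eq_bigr => i _; rewrite (ltn_eqF (ltn_ord i)).
rewrite -p'E [RHS](_ : _ = (z - y) / (z - x n.+1) *
    ((\sum_(i < n.+1) p' i) *
    ((z - x n)^-1 * \prod_(i < n) ((z - y' i) / (z - x i))))); last ring.
rewrite -y'E => [|i ilt]; last by rewrite zx// leqW.
have zn : z - x n.+1 != 0 by rewrite subr_eq0 zx.
transitivity (\sum_(i < n.+2) ((z - y) / (z - x n.+1) *
    (p' i / (z - x i)) + (y - x n.+1) / (z - x n.+1) * (p i / (y - x i)))).
  apply: eq_bigr => i _; have zi : z - x i != 0 by rewrite subr_eq0 zx// -ltnS.
  have yi : y - x i != 0.
    have := ltn_ord i; rewrite ltnS leq_eqVlt => /predU1P[->|ilt].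
      by rewrite subr_eq0 lt_eqF.
    by rewrite subr_eq0 gt_eqF// xlt.
  by rewrite /p'; field; rewrite zi yi zn.
rewrite big_split /= -!mulr_sumr yE mulr0 addr0 big_ord_recr /=.
by rewrite /p' subrr !(mul0r, mulr0) addr0.
Qed.

(** * Step functions on a grid *)

Definition grid {R : realType} (a b : R) (n i : nat) : R :=
  a + i%:R * ((b - a) / n.+1%:R).

Section grid_theory.
Variables (R : realType) (a b : R).
Hypothesis ab : a < b.

Lemma grid_start n : grid a b n 0 = a.
Proof. by rewrite /grid mul0r addr0. Qed.

Lemma grid_end n : grid a b n n.+1 = b.
Proof. by rewrite /grid mulrCA divff ?pnatr_eq0// mulr1 addrC subrK. Qed.

Lemma gridS n i : grid a b n i.+1 = grid a b n i + (b - a) / n.+1%:R.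
Proof. by rewrite /grid -addrA; congr (_ + _); rewrite -natr1; ring. Qed.

Lemma grid_step n i : grid a b n i.+1 - grid a b n i = (b - a) / n.+1%:R.
Proof. by rewrite gridS addrAC subrr add0r. Qed.

Lemma grid_step_gt0 n : 0 < (b - a) / n.+1%:R.
Proof. by rewrite divr_gt0 ?subr_gt0// ltr0n. Qed.

Lemma grid_ltS n i : grid a b n i < grid a b n i.+1.
Proof. by rewrite gridS ltrDl grid_step_gt0. Qed.

Lemma grid_le n i j : (i <= j)%N -> grid a b n i <= grid a b n j.
Proof.
move=> ij; rewrite lerD2l ler_wpM2r ?ler_nat//; exact/ltW/grid_step_gt0.
Qed.

Lemma grid_itv n i : (i <= n.+1)%N -> a <= grid a b n i <= b.
Proof.
move=> ilt; have := grid_le n (leq0n i); rewrite grid_start => ->.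
by have := grid_le n ilt; rewrite grid_end.
Qed.

Lemma grid_itvE n i : (i <= n.+1)%N -> grid a b n i \in `[a, b].
Proof. by rewrite in_itv/=; exact: grid_itv. Qed.

Lemma grid_step_cvg0 (c : R) : c * ((b - a) / n.+1%:R) @[n --> \oo] --> 0.
Proof.
rewrite -[X in _ --> X](mulr0 c); apply: cvgM; first exact: cvg_cst.
rewrite -[X in _ --> X](mulr0 (b - a)); apply: cvgM; first exact: cvg_cst.
exact: cvg_harmonic.
Qed.

End grid_theory.

Section step_approximation.
Variables (R : realType) (a b : R) (f : R -> R).
Hypotheses (ab : a < b) (fnd : {in `[a, b] &, {homo f : s t / s <= t}}).

(** The value of [f] at the first grid node that is not below [s]. Writing it with indicators of
    [a, t] makes its integral a combination of values of the distribution function. *)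
Definition step_upper (n : nat) (s : R) : R :=
  f b - \sum_(j < n.+1) (f (grid a b n j.+1) - f (grid a b n j)) *
                        \1_(`[a, grid a b n j]) s.

Lemma step_upper_bound (n : nat) (e : R) :
  (forall j, (j <= n)%N -> f (grid a b n j.+1) - f (grid a b n j) <= e) ->
  forall s, s \in `[a, b] -> f s <= step_upper n s <= f s + e.
Proof.
move=> fe s sab; rewrite /step_upper.
have e0 : 0 <= e.
  apply: le_trans (fe 0%N _); rewrite // subr_ge0.
  by apply: fnd; rewrite ?grid_itvE// grid_le.
have indE j : \1_(`[a, grid a b n j]) s = (s <= grid a b n j)%R%:R :> R.
  rewrite indicE; congr (nat_of_bool _)%:R; apply/idP/idP; rewrite inE /= in_itv/=.
    by case/andP.
  by move=> ->; move: sab; rewrite in_itv/= => /andP[->].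
under eq_bigr do rewrite indE.
suff H m : (m <= n.+1)%N -> s <= grid a b n m ->
    f s <= f (grid a b n m) - \sum_(j < m) (f (grid a b n j.+1) -
      f (grid a b n j)) * (s <= grid a b n j)%R%:R <= f s + e.
  have := H _ (leqnn n.+1); rewrite grid_end; apply.
  by move: sab; rewrite in_itv/= => /andP[].
elim: m => [_|m IHm mn].
  rewrite grid_start big_ord0 subr0 => sa.
  suff -> : s = a by rewrite lexx lerDl.
  by apply/eqP; rewrite eq_le sa; move: sab; rewrite in_itv/= => /andP[->].
rewrite big_ord_recr /=; have [sm _|ms sm] := leP s (grid a b n m).
  rewrite [X in _ <= X <= _](_ : _ = f (grid a b n m) -
    \sum_(j < m) (f (grid a b n j.+1) - f (grid a b n j)) *
                 (s <= grid a b n j)%R%:R); first exact: IHm (ltnW mn) sm.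
  by rewrite mulr1; ring.
rewrite mulr0 addr0 big1 ?subr0 => [|j _]; last first.
  by rewrite leNgt (le_lt_trans _ ms) ?mulr0// grid_le// ltnW.
have gm := grid_itvE ab mn; have gm' := grid_itvE ab (ltnW mn).
rewrite fnd//= -lerBlDl (le_trans _ (fe m mn))// lerB// fnd//.
exact: ltW.
Qed.

End step_approximation.

Lemma nondecreasing_in_measurable (R : realType) (a b : R) (f : R -> R) :
  {in `[a, b] &, {homo f : s t / s <= t}} -> measurable_fun `[a, b] f.
Proof.
move=> fnd; have [ba|ab] := ltP b a.
  by rewrite set_itv_ge ?bnd_simp -?ltNge//; exact: measurable_fun_set0.
(* Composing with the projection onto [a, b] extends [f] to a function monotone on the whole
   line. *)
pose clamp s := Num.max a (Num.min s b).
have clampE s : s \in `[a, b] -> clamp s = s.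
  by rewrite in_itv/= => /andP[sa sb]; rewrite /clamp min_l// max_r.
have clamp_in s : clamp s \in `[a, b].
  by rewrite in_itv/= /clamp le_max lexx/= ge_max ab ge_min lexx orbT.
apply: (@eq_measurable_fun _ _ _ _ _ (f \o clamp)).
  by move=> s; rewrite inE /= => sab; rewrite clampE.
apply: nondecreasing_measurable => // s t st; rewrite /= fnd//.
rewrite /clamp ge_max !le_max lexx/=; apply/orP; right.
by rewrite le_min !ge_min st lexx orbT.
Qed.

(** A Riemann-Stieltjes sum of f dG after summation by parts, an atom at [a] included. It involves
    finitely many values of [G], so it passes to pointwise limits of [G]. *)
Definition grid_sum {R : realType} (a b : R) (n : nat) (f G : R -> R) : R :=
  f b * G b - \sum_(j < n.+1) (f (grid a b n j.+1) - f (grid a b n j)) *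
                              G (grid a b n j).

Section integral_grid_sum.
Variables (R : realType) (a b : R) (f : R -> R).
Variable nu : {measure set (measurableTypeR R) -> \bar R}.
Hypotheses (ab : a < b) (fnd : {in `[a, b] &, {homo f : s t / s <= t}}).
Hypothesis nufin : (nu `[a, b]%classic < +oo)%E.

Lemma bounded_measurable_integrable (g : R -> R) (M : R) :
  measurable_fun (`[a, b] : set R) g ->
  (forall s, s \in `[a, b] -> `|g s| <= M) ->
  nu.-integrable `[a, b] (EFin \o g).
Proof.
move=> mg gM; apply: measurable_bounded_integrable => //.
exists M; split; first exact: num_real.
by move=> x Mx s /= sab; apply: le_trans (gM _ sab) (ltW Mx).
Qed.

Lemma nondecreasing_integrable : nu.-integrable `[a, b] (EFin \o f).
Proof.
apply: (@bounded_measurable_integrable _ (Num.max `|f a| `|f b|)).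
  exact: nondecreasing_in_measurable.
move=> s sab; have := sab; rewrite in_itv/= => /andP[sa sb].
have fas : f a <= f s by rewrite fnd// in_itv/= lexx ltW.
have fsb : f s <= f b by rewrite fnd// in_itv/= lexx ltW.
rewrite le_max; have [fs0|fs0] := leP 0 (f s).
  by rewrite orbC ger0_norm ?(le_trans fs0) ?ler_norm// (le_trans fsb)// ler_norm.
by rewrite ltr0_norm// ltr0_norm ?lerN2 ?fas// (le_lt_trans fas).
Qed.

Lemma integrable_step (t c : R) :
  nu.-integrable `[a, b] (EFin \o (fun s => c * \1_(`[a, t]) s)).
Proof.
apply: (@bounded_measurable_integrable _ `|c|).
  by apply: measurable_funM => //; exact: measurable_indic.
move=> s _; rewrite normrM ler_piMr// indicE.
by case: (_ \in _); rewrite ?normr1 ?normr0.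
Qed.

Lemma Rintegral_step_upper (n : nat) :
  \int[nu]_(s in `[a, b]) step_upper a b f n s =
  grid_sum a b n f (fun t => fine (nu `[a, t]%classic)).
Proof.
have intS m : nu.-integrable `[a, b] (EFin \o (fun s => \sum_(j < m)
    (f (grid a b n j.+1) - f (grid a b n j)) * \1_(`[a, grid a b n j]) s)).
  under [X in _.-integrable _ X]eq_fun do rewrite /= -sumEFin.
  by apply: integrable_sum => // j _; exact: integrable_step.
rewrite /step_upper RintegralB//; last first.
  apply: (@bounded_measurable_integrable _ `|f b|) => //; exact: measurable_cst.
congr (_ - _); first by rewrite Rintegral_cst.
suff H m : (m <= n.+1)%N -> \int[nu]_(s in `[a, b]) (\sum_(j < m)
      (f (grid a b n j.+1) - f (grid a b n j)) * \1_(`[a, grid a b n j]) s) =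
    \sum_(j < m) (f (grid a b n j.+1) - f (grid a b n j)) *
      fine (nu `[a, grid a b n j]%classic) by exact: H.
elim: m => [_|m IHm mn].
  under eq_Rintegral do rewrite big_ord0.
  by rewrite big_ord0 Rintegral_cst// mul0r.
under eq_Rintegral do rewrite big_ord_recr /=.
rewrite RintegralD//; [|exact: intS|exact: integrable_step].
rewrite IHm ?(ltnW mn)// big_ord_recr /=; congr (_ + _).
rewrite RintegralZl//; last first.
  apply: (@bounded_measurable_integrable _ 1) => [|s _].
    exact: measurable_indic.
  by rewrite indicE; case: (_ \in _); rewrite ?normr1 ?normr0.
congr (_ * _); rewrite /Rintegral integral_indic// setIidl//.
apply: subset_itvl; rewrite bnd_simp.
by have /andP[] := grid_itv ab (ltnW mn).
Qed.

Lemma Rintegral_grid_sum (n : nat) (e : R) :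
  (forall j, (j <= n)%N -> f (grid a b n j.+1) - f (grid a b n j) <= e) ->
  `|\int[nu]_(s in `[a, b]) f s -
    grid_sum a b n f (fun t => fine (nu `[a, t]%classic))| <=
  e * fine (nu `[a, b]%classic).
Proof.
move=> fe; have fS := step_upper_bound ab fnd fe.
have intf := nondecreasing_integrable.
have inte : nu.-integrable `[a, b] (EFin \o (fun=> e)).
  by apply: (@bounded_measurable_integrable _ `|e|) => //; exact: measurable_cst.
have intS : nu.-integrable `[a, b] (EFin \o step_upper a b f n).
  apply: (@bounded_measurable_integrable _ (`|f a| + `|f b| + e)).
    apply: measurable_funB; first exact: measurable_cst.
    apply: measurable_sum => j; apply: measurable_funM.
      exact: measurable_cst.
    exact: measurable_indic.
  move=> s sab; have := sab; rewrite in_itv/= => /andP[sa sb].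
  have := fS _ sab.
  have fas : f a <= f s by rewrite fnd// in_itv/= lexx ltW.
  have fsb : f s <= f b by rewrite fnd// in_itv/= lexx ltW.
  have := ler_norm (f b); have := ler_norm (- f a); rewrite normrN.
  have := normr_ge0 (f a); have := normr_ge0 (f b).
  by move=> ? ? ? ? /andP[? ?]; rewrite ler_norml; apply/andP; split; lra.
rewrite -Rintegral_step_upper distrC -RintegralB// ger0_norm; last first.
  by apply: Rintegral_ge0 => s sab; rewrite subr_ge0; have /andP[] := fS _ sab.
rewrite -Rintegral_cst//; apply: le_Rintegral => // [|s sab].
  by have := integrableB _ intS intf; apply.
by have /andP[_] := fS _ sab; rewrite -lerBlDl.
Qed.

End integral_grid_sum.

(** * Limits of measures *)

(** By compactness the image ultrafilter has a cluster point, which for an ultrafilter is a limit.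
    One [U] serves all sequences at once, so no diagonal extraction over the points of the line is
    needed. *)
Lemma ultrafilter_bounded_cvg (R : realType) (U : set_system nat)
    (u : nat -> R) (m M : R) :
  UltraFilter U -> (forall n, m <= u n <= M) -> exists l : R, u @ U --> l.
Proof.
move=> UU um; have UP : ProperFilter U by exact: ultra_proper.
have [|l [_ lU]] := @segment_compact R m M (u @ U) _.
  by apply: (@filterS _ U _ setT) filterT => n _ /=; rewrite in_itv/= um.
exists l => A lA; have [//|UA] := in_ultra_setVsetC (u @^-1` A) UU.
have [x [Ax]] := lU (~` A) A UA lA.
by rewrite /setC/=.
Qed.

Lemma stieltjes_itvoc (R : realType) (F : cumulative R R) (s t : R) :
  s <= t -> lebesgue_stieltjes_measure F `]s, t]%classic = (F t - F s)%:E.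
Proof.
move=> st; rewrite /lebesgue_stieltjes_measure /measure_extension/=.
rewrite measurable_mu_extE/=; last exact: is_ocitv.
by rewrite wlength_itv_bnd.
Qed.

Lemma half_diagram_lipschitz (R : realType) (w : continual_diagram R)
    (s t : R) :
  s <= t -> 0 <= half_diagram w t - half_diagram w s <= t - s.
Proof.
move=> st; have := diagram_lipschitz w t s.
rewrite ler_norml [`|t - s|]ger0_norm ?subr_ge0// /half_diagram.
by move=> /andP[? ?]; apply/andP; split; lra.
Qed.

Lemma half_diagram_itvcc (R : realType) (w : continual_diagram R) (s t : R) :
  s <= t -> lebesgue_stieltjes_measure (half_diagram w) `[s, t]%classic =
            (half_diagram w t - half_diagram w s)%:E.
Proof.
move=> st.
pose nu : {measure set (measurableTypeR R) -> \bar R} :=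
  lebesgue_stieltjes_measure (half_diagram w).
(* No atoms: by the Lipschitz bound, the interval of length [e] ending at [s] has mass at most
   [e]. *)
have nus : nu [set s] = 0%E.
  apply/eqP; rewrite eq_le measure_ge0 andbT; apply/lee_addgt0Pr => e e0.
  rewrite add0e; apply: (@le_trans _ _ (nu `](s - e), s]%classic)).
    apply: le_measure; rewrite ?inE; [exact: measurable_set1|exact: measurable_itv|].
    by move=> x /= ->; rewrite in_itv/= lexx ltrBlDr ltrDl e0.
  have se : s - e <= s by rewrite lerBlDr lerDl ltW.
  rewrite [leLHS]stieltjes_itvoc// lee_fin.
  have /andP[_] := half_diagram_lipschitz w se.
  by rewrite subKr.
rewrite -(@setU1itv _ _ (BRight t) s false) ?bnd_simp//.
rewrite [LHS](@measureU _ _ _ nu)//=; last first.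
  by apply/seteqP; split => x //= -[->]; rewrite in_itv/= ltxx.
rewrite [X in (X + _)%E]nus add0e; exact: stieltjes_itvoc.
Qed.

(** A pointwise limit of distribution functions need not be right-continuous. The measure is built
    from the regularisation H t = inf of G over ]t, +oo[, and the sandwich in the conclusion is what
    remains of the link with [G]. *)
Lemma distribution_function_probability (R : realType) (a b : R)
    (G : R -> R) :
  {homo G : s t / s <= t} ->
  (forall t, t < a -> G t = 0) -> (forall t, b <= t -> G t = 1) ->
  exists2 mu : probability (measurableTypeR R) R, prob_measures a b mu &
    forall t u, a <= t -> t < u -> G t <= fine (mu `[a, t]%classic) <= G u.
Proof.
move=> Gnd G0 G1.
have G01 t : 0 <= G t <= 1.
  have <- : G (Num.min t (a - 1)) = 0.
    by rewrite G0// gt_min ltrBlDr ltrDl ltr01 orbT.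
  have <- : G (Num.max t b) = 1 by rewrite G1// le_max lexx orbT.
  by rewrite !Gnd ?le_max ?ge_min ?lexx.
pose H t := inf (G @` `]t, +oo[).
have Hlb t : has_lbound (G @` `]t, +oo[).
  by exists 0 => _ [u _ <-]; have /andP[] := G01 u.
have HG t u : t < u -> H t <= G u.
  by move=> tu; apply: ge_inf => //; exists u => //=; rewrite in_itv/= tu.
have Hge t l : (forall u, t < u -> l <= G u) -> l <= H t.
  move=> lG; apply: lb_le_inf; last first.
    by move=> y [u /=]; rewrite in_itv/= andbT => tu <-; exact: lG.
  by exists (G (t + 1)), (t + 1) => //=; rewrite in_itv/= andbT ltrDl.
have GH t : G t <= H t by apply: Hge => u tu; rewrite Gnd// ltW.
have Hnd : {homo H : s t / s <= t}.
  by move=> s t st; apply: Hge => u tu; apply: HG; exact: le_lt_trans tu.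
have H0 t : t < a -> H t = 0.
  move=> ta; apply/eqP; rewrite eq_le; apply/andP; split.
    rewrite -(G0 ((t + a) / 2)); last by rewrite midf_lt.
    by apply: HG; rewrite midf_lt.
  by apply: le_trans (GH t); have /andP[] := G01 t.
have H1 t : b <= t -> H t = 1.
  move=> bt; apply/eqP; rewrite eq_le; apply/andP; split; last first.
    by rewrite -(G1 t).
  rewrite -(G1 (t + 1)) ?(le_trans bt) ?lerDl//.
  by apply: HG; rewrite ltrDl.
have Hrc : right_continuous H.
  move=> t; apply/cvgrPdist_le => e e0.
  have [y [u /= + <-]] : exists2 y, (G @` `]t, +oo[) y & y < H t + e.
    apply: inf_lt; last by rewrite ltrDl.
    by exists (G (t + 1)), (t + 1) => //=; rewrite in_itv/= andbT ltrDl.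
  rewrite in_itv/= andbT => tu Gu.
  near=> s.
  have ts : t < s by near: s; exact: nbhs_right_gt.
  have su : s < u by near: s; exact: nbhs_right_lt.
  have Hts : H t <= H s by exact/Hnd/ltW.
  rewrite distrC ger0_norm ?subr_ge0// lerBlDl.
  exact/ltW/(le_lt_trans (HG _ _ su)).
have HNy : H @ -oo --> (0 : R).
  apply: cvg_near_cst; near=> t; apply: H0.
  by near: t; exact/nbhs_ninfty_lt/num_real.
have Hy : H @ +oo --> (1 : R).
  apply: cvg_near_cst; near=> t; apply: H1.
  by near: t; exact/nbhs_pinfty_ge/num_real.
pose Fc : cumulativeBounded (0 : R) (1 : R) := HB.pack H
  (isCumulative.Build R _ R H Hnd Hrc)
  (isCumulativeBounded.Build R 0 1 H HNy Hy).
pose mu : probability (measurableTypeR R) R := lebesgue_stieltjes_measure Fc.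
have muoc s t : s <= t -> mu `]s, t]%classic = (H t - H s)%:E.
  by move=> st; exact: (stieltjes_itvoc Fc).
(* [H] may jump at [a], which gives an atom there; the open interval to the left is exhausted by
   half-open intervals on which [H] is 0. *)
have mu0 : mu `](a - 1), a[%classic = 0%E.
  apply/eqP; rewrite eq_le measure_ge0 andbT.
  have : mu.-negligible (\bigcup_n `](a - 1), (a - n.+1%:R^-1)]%classic).
    apply: negligible_bigcup => n; apply/negligibleP; first exact: measurable_itv.
    apply: etrans (muoc _ _ _) _; first by rewrite lerB// invf_le1 ?ler1n ?ltr0n.
    by rewrite !H0 ?subr0// ltrBlDr ltrDl// invr_gt0 ltr0n.
  move/negligibleP => <-; last exact: bigcup_measurable.
  apply: le_measure; rewrite ?inE//; first exact: bigcup_measurable.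
  move=> s /=; rewrite in_itv/= => /andP[as1 sa].
  have [n /= na] : exists n, n.+1%:R^-1 <= a - s.
    exists (Num.truncn (a - s)^-1).
    rewrite -[leRHS]invrK lef_pV2 ?posrE ?invr_gt0 ?subr_gt0 ?ltr0n//.
    by rewrite ltW// truncnS_gt.
  by exists n => //=; rewrite in_itv/= as1/= lerBrDr -lerBrDl.
have mucc t : a <= t -> mu `[a, t]%classic = (H t)%:E.
  move=> at_; have : mu `](a - 1), t]%classic = (H t)%:E.
    by rewrite muoc ?(H0 (a - 1)) ?subr0//; lra.
  rewrite (@itv_bndbnd_setU _ _ _ (BLeft a)) ?bnd_simp//; last by lra.
  rewrite measureU//; last first.
    apply/seteqP; split => x //= []; rewrite !in_itv/= => /andP[_ xa] /andP[ax _].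
    by move: xa; rewrite ltNge ax.
  by rewrite [X in (X + _)%E = _ -> _]mu0 add0e.
exists mu.
  have [ab|ba] := leP a b; first by rewrite /prob_measures/= mucc// H1.
  have := G0 b ba; rewrite G1// => /eqP; by rewrite oner_eq0.
by move=> t u at_ tu; rewrite mucc//= GH HG.
Unshelve. all: by end_near. Qed.

(** The test functions of the weak limits: for fixed x outside [a, b], both the Cauchy kernel and
    the logarithmic kernel are of this kind in s. *)
Definition nondecreasing_lipschitz {R : realType} (a b l : R) (f : R -> R) :=
  forall s t, a <= s -> s <= t -> t <= b -> 0 <= f t - f s <= l * (t - s).

Lemma nondecreasing_lipschitz_homo (R : realType) (a b l : R) (f : R -> R) :
  nondecreasing_lipschitz a b l f -> {in `[a, b] &, {homo f : s t / s <= t}}.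
Proof.
move=> fl s t; rewrite !in_itv/= => /andP[sa _] /andP[_ tb] st.
by rewrite -subr_ge0; have /andP[] := fl s t sa st tb.
Qed.

Lemma nondecreasing_lipschitz_grid (R : realType) (a b l : R) (f : R -> R)
    (n j : nat) : a < b -> nondecreasing_lipschitz a b l f -> (j <= n)%N ->
  0 <= f (grid a b n j.+1) - f (grid a b n j) <= l * ((b - a) / n.+1%:R).
Proof.
move=> ab fl jn; have /andP[aj _] := grid_itv ab (leqW jn).
have /andP[_ jb] := grid_itv ab (jn : (j.+1 <= n.+1)%N).
by have := fl _ _ aj (ltW (grid_ltS ab n j)) jb; rewrite grid_step.
Qed.

Lemma discrete_grid_sum (R : realType) (a b l : R) (f : R -> R)
    (n m : nat) (p c : nat -> R) :
  a < b -> nondecreasing_lipschitz a b l f ->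
  (forall i, 0 <= p i) -> \sum_(i < m.+1) p i = 1 ->
  (forall i, (i <= m)%N -> c i \in `[a, b]) ->
  `|\sum_(i < m.+1) p i * f (c i) -
    grid_sum a b n f (fun t => \sum_(i < m.+1) p i * (c i <= t)%R%:R)| <=
  l * ((b - a) / n.+1%:R).
Proof.
move=> ab fl p0 p1 cab.
have fnd := nondecreasing_lipschitz_homo fl.
have fS := step_upper_bound ab fnd (n := n)
  (fun j jn => (andP (nondecreasing_lipschitz_grid ab fl jn)).2).
have -> : grid_sum a b n f (fun t => \sum_(i < m.+1) p i * (c i <= t)%R%:R) =
    \sum_(i < m.+1) p i * step_upper a b f n (c i).
  rewrite /grid_sum /step_upper.
  under [RHS]eq_bigr do rewrite mulrBr.
  rewrite sumrB; congr (_ - _).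
    rewrite mulr_sumr; apply: eq_bigr => i _.
    have := cab i (ltn_ord i); rewrite in_itv/= => /andP[_ ->].
    by rewrite mulr1 mulrC.
  under eq_bigr do rewrite mulr_sumr.
  rewrite exchange_big /=; apply: eq_bigr => i _.
  rewrite mulr_sumr; apply: eq_bigr => j _; rewrite mulrCA; congr (_ * (_ * _)).
  rewrite indicE; congr (nat_of_bool _)%:R; apply/idP/idP; rewrite inE/= in_itv/=.
    by have := cab i (ltn_ord i); rewrite in_itv/= => /andP[-> _] ->.
  by case/andP.
rewrite distrC -sumrB ger0_norm; last first.
  apply: sumr_ge0 => i _; rewrite -mulrBr mulr_ge0// subr_ge0.
  by have /andP[] := fS _ (cab i (ltn_ord i)).
rewrite -[leRHS]mul1r -[X in _ <= X * _]p1 mulr_suml; apply: ler_sum => i _.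
rewrite -mulrBr ler_wpM2l// lerBlDl.
by have /andP[] := fS _ (cab i (ltn_ord i)).
Qed.

(** Interchange of limits by a three-epsilon argument: the error [e m] is uniform in [n], and tends
    to 0 along [\oo] in the mesh index [m] while [n] runs along [U]. *)
Lemma cvg_uniform_approximation (R : realType) (U : set_system nat)
    (u : nat -> R) (l : R) (v : nat -> nat -> R) (V e : nat -> R) :
  Filter U -> e n @[n --> \oo] --> 0 ->
  (forall m n, `|u n - v m n| <= e m) -> (forall m, `|l - V m| <= e m) ->
  (forall m, v m n @[n --> U] --> V m) -> u @ U --> l.
Proof.
move=> FU e0 uv lV vV; apply/cvgrPdist_le => d d0.
have d3 : 0 < d / 3 by rewrite divr_gt0.
have [m _ em] : \forall m \near \oo, e m <= d / 3 by exact: cvgr_le e0 _ d3.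
have {}em := em m (leqnn m).
have : \forall n \near U, `|V m - v m n| <= d / 3 by exact: cvgr_dist_le (vV m) _ d3.
apply: filterS => n Vn.
have := uv m n; have := lV m; rewrite distrC => lm um.
rewrite [X in `|X|](_ : _ = (l - V m) + (V m - v m n) + (v m n - u n)); last ring.
apply: le_trans (ler_normD _ _) _; apply: le_trans (lerD (ler_normD _ _) (lexx _)) _.
rewrite [`|l - _|]distrC [`|v m n - _|]distrC; lra.
Qed.

Lemma discrete_weak_limit (R : realType) (U : set_system nat) (a b : R)
    (p c : nat -> nat -> R) :
  UltraFilter U -> a < b ->
  (forall n i, 0 <= p n i) -> (forall n, \sum_(i < n.+1) p n i = 1) ->
  (forall n i, (i <= n)%N -> c n i \in `[a, b]) ->
  exists2 mu : probability (measurableTypeR R) R, prob_measures a b mu &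
    forall f l, nondecreasing_lipschitz a b l f ->
      \sum_(i < n.+1) p n i * f (c n i) @[n --> U] -->
      \int[mu]_(s in `[a, b]) f s.
Proof.
move=> UU ab p0 p1 cab; have UP : ProperFilter U by exact: ultra_proper.
pose Gn n t := \sum_(i < n.+1) p n i * (c n i <= t)%R%:R.
have Gn01 n t : 0 <= Gn n t <= 1.
  apply/andP; split; first by apply: sumr_ge0 => i _; rewrite mulr_ge0.
  rewrite -(p1 n); apply: ler_sum => i _.
  by rewrite ler_piMr// lern1 leq_b1.
have /choice[G GE] t : exists l : R, Gn n t @[n --> U] --> l.
  exact: (ultrafilter_bounded_cvg UU (fun n => Gn01 n t)).
have Gnd : {homo G : s t / s <= t}.
  move=> s t st; apply: (@ler_cvg_to nat U _ _ _ _ _ _ (GE s) (GE t)).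
  apply: nearW => n; apply: ler_sum => i _; rewrite ler_wpM2l// ler_nat.
  by case: (leP (c n i) s) => // cs; rewrite (le_trans cs).
have G0 t : t < a -> G t = 0.
  move=> ta; apply/esym/(cvg_unique _ _ (GE t)) => //.
  rewrite (_ : Gn ^~ t = cst 0); first exact: cvg_cst.
  apply/funext => n; apply: big1 => i _; rewrite leNgt (lt_le_trans ta) ?mulr0//.
  by have := cab n i (ltn_ord i); rewrite in_itv/= => /andP[].
have G1 t : b <= t -> G t = 1.
  move=> bt; apply/esym/(cvg_unique _ _ (GE t)) => //.
  rewrite (_ : Gn ^~ t = cst 1); first exact: cvg_cst.
  apply/funext => n; rewrite /cst -[RHS](p1 n); apply: eq_bigr => i _.
  rewrite (le_trans _ bt) ?mulr1//.
  by have := cab n i (ltn_ord i); rewrite in_itv/= => /andP[].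
have [mu muab muG] := distribution_function_probability Gnd G0 G1.
exists mu => // f l fl; pose e m := l * ((b - a) / m.+1%:R).
have fnd := nondecreasing_lipschitz_homo fl.
pose H t := fine (mu `[a, t]%classic).
have Hb : H b = 1 by rewrite /H [X in fine X]muab.
(* At each node, [H] exceeds [G] by at most the increment of [G] over the next cell. These
   increments telescope to at most 1, and each is multiplied by an increment of [f] bounded by
   [e m]. *)
have GH m : `|grid_sum a b m f G - grid_sum a b m f H| <= e m.
  rewrite /grid_sum Hb (G1 b)//.
  rewrite [X in `|X|](_ : _ = \sum_(j < m.+1)
      (f (grid a b m j.+1) - f (grid a b m j)) *
      (H (grid a b m j) - G (grid a b m j))); last first.
    under [RHS]eq_bigr do rewrite mulrBr.
    by rewrite sumrB; ring.
  have HG (j : 'I_m.+1) : 0 <= H (grid a b m j) - G (grid a b m j) <=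
      G (grid a b m j.+1) - G (grid a b m j).
    have /andP[aj _] := grid_itv ab (ltnW (ltn_ord j)).
    by have := muG _ _ aj (grid_ltS ab m j); rewrite subr_ge0 lerD2r.
  have fg (j : 'I_m.+1) :=
    nondecreasing_lipschitz_grid (n := m) (j := j) ab fl (ltn_ord j).
  have e0 : 0 <= e m by have /andP[h1 h2] := fg ord0; exact: le_trans h1 h2.
  rewrite ger0_norm; last first.
    apply: sumr_ge0 => j _; have /andP[? _] := HG j; have /andP[? _] := fg j.
    exact: mulr_ge0.
  apply: (@le_trans _ _ (\sum_(j < m.+1)
      e m * (G (grid a b m j.+1) - G (grid a b m j)))).
    apply: ler_sum => j _; have /andP[? ?] := HG j; have /andP[? ?] := fg j.
    exact: ler_pM.
  rewrite -mulr_sumr ler_piMr//.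
  have := telescope_sumr (fun i => G (grid a b m i)) (leq0n m.+1).
  rewrite big_mkord => ->; rewrite grid_end grid_start (G1 b)// lerBlDr lerDl.
  by rewrite -(G0 (a - 1)) ?Gnd// ?lerBlDr ?ltrBlDr ?lerDl ?ltrDl.
(* Twice [e m]: once for the grid error of the integral against [mu], once for replacing [H] by
   [G]. *)
apply: (@cvg_uniform_approximation _ _ _ _ (fun m n => grid_sum a b m f (Gn n))
    (fun m => grid_sum a b m f G) (fun m => 2 * e m)).
- rewrite /e; under eq_cvg do rewrite mulrA.
  exact: grid_step_cvg0.
- move=> m n; have := discrete_grid_sum m ab fl (p0 n) (p1 n) (cab n).
  rewrite -/(e m) -/(Gn n) => h; rewrite (le_trans h)//.
  by have := le_trans (normr_ge0 _) h; lra.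
- move=> m; have mufin : (mu `[a, b]%classic < +oo)%E by rewrite [X in (X < _)%E]muab ltry.
  have := @Rintegral_grid_sum _ _ _ f mu ab fnd mufin m (e m)
    (fun j jm => (andP (nondecreasing_lipschitz_grid ab fl jm)).2).
  rewrite -/(H b) Hb mulr1 -/H => h.
  have := GH m; rewrite distrC => h'.
  rewrite [X in `|X|](_ : _ = (\int[mu]_(s in `[a, b]) f s - grid_sum a b m f H) +
    (grid_sum a b m f H - grid_sum a b m f G)); last ring.
  by apply: le_trans (ler_normD _ _) _; lra.
- move=> m; apply: cvgB; first by apply: cvgM; [exact: cvg_cst|exact: GE].
  apply: cvg_big => [|j _]; first exact: add_continuous.
  by apply: cvgM; [exact: cvg_cst|exact: GE].
Qed.

(** * Cauchy kernels *)

(* The two kernels of the theorem are [phi = id], [al = 1], [be = 0] for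
   [q = 1], and [phi s = q `^ (- s)], [al = ln q^-1 * phi], [be = ln q^-1] for
   [q < 1]. In both cases [al x / (phi x - phi s) - be] is the derivative of
   [- ln `|phi x - phi s|] in [s]. *)
Record cauchy_kernel {R : realType} (a b : R) (phi al : R -> R) (be : R) :
    Prop := CauchyKernel {
  kernel_lt : {homo phi : s t / s < t} ;
  kernel_continuous : continuous phi ;
  kernel_lipschitz : exists l, forall s t, a <= s -> s <= t -> t <= b ->
    phi t - phi s <= l * (t - s) ;
  kernel_ge0 : forall x, 0 <= al x ;
  kernel_ln : forall x s t, ~~ (a <= x <= b) ->
    a <= s -> s <= t -> t <= b ->
    (al x / (phi x - phi s) - be) * (t - s) <=
    ln ((phi x - phi s) / (phi x - phi t)) <=
    (al x / (phi x - phi t) - be) * (t - s) }.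

Section cauchy_kernel_theory.
Variables (R : realType) (a b : R) (phi al : R -> R) (be : R).
Hypotheses (ab : a < b) (ker : cauchy_kernel a b phi al be).

Let C x s := (phi x - phi s)^-1.
Let k x s := al x / (phi x - phi s) - be.

Lemma kernel_le s t : s <= t -> phi s <= phi t.
Proof.
by rewrite le_eqVlt => /predU1P[->//|/(kernel_lt ker)]; exact: ltW.
Qed.

Lemma kernel_neq x s : ~~ (a <= x <= b) -> a <= s <= b -> phi x - phi s != 0.
Proof.
move=> xab sab; rewrite subr_eq0; have [xs|sx|xs] := ltgtP x s.
- by rewrite lt_eqF// (kernel_lt ker).
- by rewrite gt_eqF// (kernel_lt ker).
- by move: xab; rewrite xs sab.
Qed.

Lemma kernel_ratio_gt0 x s t : ~~ (a <= x <= b) -> a <= s <= b ->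
  a <= t <= b -> 0 < (phi x - phi s) / (phi x - phi t).
Proof.
rewrite negb_and -!ltNge => /orP[xa|bx] /andP[as_ sb] /andP[at_ tb].
  rewrite -mulrNN -invrN divr_gt0// opprB subr_gt0 (kernel_lt ker)//.
    exact: lt_le_trans as_.
  exact: lt_le_trans at_.
rewrite divr_gt0// subr_gt0 (kernel_lt ker)//.
  exact: le_lt_trans bx.
exact: le_lt_trans bx.
Qed.

(** C t - C s = (phi t - phi s) C s C t, and C s C t > 0 since phi x - phi s keeps one sign for s in
    [a, b]. Monotonicity bounds C by its end values, hence the constant. *)
Lemma cauchy_nondecreasing_lipschitz x : ~~ (a <= x <= b) ->
  exists l, nondecreasing_lipschitz a b l (C x).
Proof.
move=> xab; have [l phil] := kernel_lipschitz ker.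
have CB s t : a <= s <= b -> a <= t <= b ->
    C x t - C x s = (phi t - phi s) * (C x s * C x t).
  by move=> sab tab; rewrite /C; field; rewrite !kernel_neq.
have C0 s t : a <= s <= b -> a <= t <= b -> 0 < C x s * C x t.
  move=> sab tab; have := kernel_ratio_gt0 xab tab sab.
  rewrite /C => h; rewrite -(pmulr_rgt0 _ (_ : 0 < (phi x - phi t) ^+ 2)).
    suff -> : (phi x - phi t) ^+ 2 * ((phi x - phi s)^-1 / (phi x - phi t)) =
      (phi x - phi t) / (phi x - phi s) by [].
    by field; rewrite !kernel_neq.
  by rewrite exprn_even_gt0//= kernel_neq.
have aab : a <= a <= b by rewrite lexx ltW.
have bab : a <= b <= b by rewrite lexx ltW.
have Cnd s t : a <= s <= b -> a <= t <= b -> s <= t -> C x s <= C x t.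
  move=> sab tab st; rewrite -subr_ge0 CB// mulr_ge0//.
    by rewrite subr_ge0 kernel_le.
  exact/ltW/C0.
pose M := `|C x a| + `|C x b|.
have CM s : a <= s <= b -> `|C x s| <= M.
  move=> sab; have /andP[as_ sb] := sab.
  have := Cnd _ _ aab sab as_; have := Cnd _ _ sab bab sb.
  have := ler_norm (C x b); have := ler_norm (- C x a); rewrite normrN.
  have := normr_ge0 (C x a); have := normr_ge0 (C x b).
  by move=> ? ? ? ? ? ?; rewrite ler_norml /M; apply/andP; split; lra.
exists (l * (M * M)) => s t as_ st tb.
have sab : a <= s <= b by rewrite as_ (le_trans st).
have tab : a <= t <= b by rewrite tb (le_trans as_).
rewrite subr_ge0 Cnd//= CB// mulrAC.
have phi0 : 0 <= phi t - phi s by rewrite subr_ge0 kernel_le.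
apply: ler_pM => //; [exact/ltW/C0|exact: phil|].
apply: le_trans (ler_norm _) _; rewrite normrM.
by apply: ler_pM => //; exact: CM.
Qed.

Lemma log_kernel_nondecreasing_lipschitz x : ~~ (a <= x <= b) ->
  exists l, nondecreasing_lipschitz a b l (k x).
Proof.
move=> /cauchy_nondecreasing_lipschitz[l Cl].
exists (al x * l) => s t as_ st tb.
have := Cl s t as_ st tb; rewrite /C => /andP[C0 Cle].
rewrite /k [X in 0 <= X <= _](_ : _ = al x * ((phi x - phi t)^-1 -
  (phi x - phi s)^-1)); last ring.
by rewrite mulr_ge0 ?(kernel_ge0 ker)//= -mulrA ler_wpM2l// (kernel_ge0 ker).
Qed.

Lemma prod_ratioE x n (c d : nat -> R) : ~~ (a <= x <= b) ->
  (forall i, (i < n)%N -> a <= c i <= b) ->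
  (forall i, (i < n)%N -> a <= d i <= b) ->
  \prod_(i < n) ((phi x - phi (d i)) / (phi x - phi (c i))) =
  expR (- \sum_(i < n) ln ((phi x - phi (c i)) / (phi x - phi (d i)))).
Proof.
move=> xab cab dab; elim: n cab dab => [|n IHn] cab dab.
  by rewrite !big_ord0 oppr0 expR0.
have {}IHn := IHn (fun i ilt => cab i (leqW ilt)) (fun i ilt => dab i (leqW ilt)).
rewrite !big_ord_recr /= opprD expRD IHn; congr (_ * _).
by rewrite -lnV ?posrE ?kernel_ratio_gt0 ?cab ?dab// lnK ?invf_div// posrE
  kernel_ratio_gt0 ?cab ?dab.
Qed.

End cauchy_kernel_theory.

(** * Logarithms of products as approximate charge integrals *)

Lemma grid_sum_parts (R : realType) (a b : R) (n : nat) (f G : R -> R) :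
  grid_sum a b n f G = f a * G a + \sum_(i < n.+1) f (grid a b n i.+1) *
    (G (grid a b n i.+1) - G (grid a b n i)).
Proof.
have := telescope_sumr (fun i => f (grid a b n i) * G (grid a b n i))
  (leq0n n.+1).
rewrite big_mkord grid_end grid_start => fG.
rewrite /grid_sum -[f b * G b](subrK (f a * G a)) -fG addrAC addrC; congr (_ + _).
by rewrite -sumrB; apply: eq_bigr => i _; ring.
Qed.

Section charge_sums.
Variables (R : realType) (a b : R).
Hypothesis ab : a < b.

(** The bound is free of [w] because the total mass, the increment of [half_diagram w] over [a, b],
    is at most b - a. *)
Lemma half_diagram_grid_sum (w : continual_diagram R) (l : R) (f : R -> R)
    (n : nat) : nondecreasing_lipschitz a b l f ->
  `|\int[lebesgue_stieltjes_measure (half_diagram w)]_(s in `[a, b]) f s -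
    \sum_(i < n.+1) f (grid a b n i.+1) *
      (half_diagram w (grid a b n i.+1) - half_diagram w (grid a b n i))| <=
  (l * (b - a)) * ((b - a) / n.+1%:R).
Proof.
move=> fl; pose nu : {measure set (measurableTypeR R) -> \bar R} :=
  lebesgue_stieltjes_measure (half_diagram w).
pose H t := fine (nu `[a, t]%classic).
have HE t : a <= t -> H t = half_diagram w t - half_diagram w a.
  by move=> at_; rewrite /H [X in fine X](half_diagram_itvcc w at_).
have nufin : (nu `[a, b]%classic < +oo)%E.
  by rewrite [X in (X < _)%E](half_diagram_itvcc w (ltW ab)) ltry.
have fe j (jn : (j <= n)%N) :=
  (andP (nondecreasing_lipschitz_grid (n := n) ab fl jn)).2.
have h : `|\int[nu]_(s in `[a, b]) f s - grid_sum a b n f H| <=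
    l * ((b - a) / n.+1%:R) * H b.
  exact: (@Rintegral_grid_sum _ _ _ f nu ab (nondecreasing_lipschitz_homo fl) nufin n _ fe).
have gE : grid_sum a b n f H = \sum_(i < n.+1) f (grid a b n i.+1) *
    (half_diagram w (grid a b n i.+1) - half_diagram w (grid a b n i)).
  rewrite grid_sum_parts (HE a)// subrr mulr0 add0r.
  apply: eq_bigr => i _; congr (_ * _).
  have /andP[ai _] := grid_itv ab (ltnW (ltn_ord i)).
  have /andP[ai1 _] := grid_itv ab (ltn_ord i).
  by rewrite !HE//; ring.
rewrite -gE; apply: le_trans h _; rewrite (HE b (ltW ab)).
rewrite [leRHS]mulrAC ler_wpM2l//; last first.
  by have /andP[_] := half_diagram_lipschitz w (ltW ab).
have /andP[] := nondecreasing_lipschitz_grid (n := n) ab fl (leq0n n).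
by move=> h1 h2; exact: le_trans h1 h2.
Qed.

Variables (phi al : R -> R) (be : R).
Hypothesis ker : cauchy_kernel a b phi al be.

(** On each cell, dF is replaced by Lebesgue measure on a subinterval [c i, d i] of equal mass, over
    which the kernel integrates to the logarithm. By [kernel_ln], that logarithm lies between the
    mass times the kernel values at the two ends of the cell. The factor 2 in the constant adds this
    error to that of the Riemann sum. *)
Lemma log_sum_charge (x : R) : ~~ (a <= x <= b) ->
  exists l, forall n (w : continual_diagram R) (c d : nat -> R),
    (forall i, (i <= n)%N ->
       [/\ grid a b n i <= c i, c i <= d i, d i <= grid a b n i.+1 &
        d i - c i = half_diagram w (grid a b n i.+1) -
                    half_diagram w (grid a b n i)]) ->
    `|\int[lebesgue_stieltjes_measure (half_diagram w)]_(s in `[a, b])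
        (al x / (phi x - phi s) - be) -
      \sum_(i < n.+1) ln ((phi x - phi (c i)) / (phi x - phi (d i)))| <=
    l * ((b - a) / n.+1%:R).
Proof.
move=> xab; have [l kl] := log_kernel_nondecreasing_lipschitz ab ker xab.
exists (2 * (l * (b - a))) => n w c d cd.
pose k s := al x / (phi x - phi s) - be.
pose D i := half_diagram w (grid a b n i.+1) - half_diagram w (grid a b n i).
have h1 := half_diagram_grid_sum w n kl.
have knd := nondecreasing_lipschitz_homo kl.
suff h2 : `|\sum_(i < n.+1) k (grid a b n i.+1) * D i -
    \sum_(i < n.+1) ln ((phi x - phi (c i)) / (phi x - phi (d i)))| <=
    (l * (b - a)) * ((b - a) / n.+1%:R).
  rewrite [X in `|X|](_ : _ =
    (\int[lebesgue_stieltjes_measure (half_diagram w)]_(s in `[a, b]) k s -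
      \sum_(i < n.+1) k (grid a b n i.+1) * D i) +
    (\sum_(i < n.+1) k (grid a b n i.+1) * D i -
     \sum_(i < n.+1) ln ((phi x - phi (c i)) / (phi x - phi (d i))))); last first.
    by rewrite -/k; ring.
  apply: le_trans (ler_normD _ _) _; rewrite -mulrA mulr_natl mulr2n.
  exact: lerD.
have D0 i : 0 <= D i.
  by have /andP[] := half_diagram_lipschitz w (ltW (grid_ltS ab n i)).
have kD (i : 'I_n.+1) : k (grid a b n i) * D i <=
    ln ((phi x - phi (c i)) / (phi x - phi (d i))) <= k (grid a b n i.+1) * D i.
  have [ti cdi dt E] := cd i (ltn_ord i).
  have /andP[ai ib] := grid_itv ab (ltnW (ltn_ord i)).
  have /andP[ai1 ib1] := grid_itv ab (ltn_ord i).
  have ac := le_trans ai ti; have db := le_trans dt ib1.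
  have ad := le_trans ac cdi; have cb := le_trans cdi db.
  have /andP[hl hr] := kernel_ln ker xab ac cdi db.
  rewrite -/(k (c i)) E -/(D i) in hl; rewrite -/(k (d i)) E -/(D i) in hr.
  rewrite (le_trans _ hl) ?(le_trans hr)// ler_wpM2r// knd// in_itv/=.
  - by rewrite ad.
  - by rewrite ai1.
  - by rewrite ai.
  - by rewrite ac.
rewrite -sumrB ger0_norm; last first.
  by apply: sumr_ge0 => i _; rewrite subr_ge0; have /andP[] := kD i.
have kg (i : 'I_n.+1) :=
  nondecreasing_lipschitz_grid (n := n) (j := i) ab kl (ltn_ord i).
apply: (@le_trans _ _ (\sum_(i < n.+1) l * ((b - a) / n.+1%:R) * D i)).
  apply: ler_sum => i _; have /andP[hl hr] := kD i; have /andP[_ hg] := kg i.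
  apply: (@le_trans _ _ ((k (grid a b n i.+1) - k (grid a b n i)) * D i)).
    by rewrite [leRHS]mulrBl lerB.
  by rewrite ler_wpM2r.
rewrite -mulr_sumr [leRHS]mulrAC ler_wpM2l//.
  by have /andP[p1 p2] := kg ord0; exact: le_trans p1 p2.
have := telescope_sumr (fun i => half_diagram w (grid a b n i)) (leq0n n.+1).
rewrite big_mkord grid_end grid_start => ->.
by have /andP[] := half_diagram_lipschitz w (ltW ab).
Qed.

(** The diagram is allowed to vary with [n]: it is constant when a measure is built from a diagram,
    and an interpolating diagram of the n-th grid in the other direction. *)
Lemma log_sum_cvg (x : R) (w : nat -> continual_diagram R)
    (W : continual_diagram R) (U : set_system nat) (c d : nat -> nat -> R) :
  ~~ (a <= x <= b) -> Filter U -> \oo `<=` U ->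
  (forall s, w n s @[n --> U] --> W s) ->
  (forall n i, (i <= n)%N ->
     [/\ grid a b n i <= c n i, c n i <= d n i, d n i <= grid a b n i.+1 &
      d n i - c n i = half_diagram (w n) (grid a b n i.+1) -
                      half_diagram (w n) (grid a b n i)]) ->
  \sum_(i < n.+1) ln ((phi x - phi (c n i)) / (phi x - phi (d n i)))
    @[n --> U] -->
  \int[lebesgue_stieltjes_measure (half_diagram W)]_(s in `[a, b])
    (al x / (phi x - phi s) - be).
Proof.
move=> xab FU ooU wW cd; have [l kl] := log_kernel_nondecreasing_lipschitz ab ker xab.
pose k s := al x / (phi x - phi s) - be.
pose I v := \int[lebesgue_stieltjes_measure (half_diagram v)]_(s in `[a, b]) k s.
have hW t : half_diagram (w n) t @[n --> U] --> half_diagram W t.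
  apply: cvgM; first exact: cvg_cst.
  by apply: cvgD; [exact: wW|exact: cvg_cst].
have IW : I (w n) @[n --> U] --> I W.
  apply: (@cvg_uniform_approximation _ _ _ _
    (fun m n => \sum_(i < m.+1) k (grid a b m i.+1) *
      (half_diagram (w n) (grid a b m i.+1) - half_diagram (w n) (grid a b m i)))
    (fun m => \sum_(i < m.+1) k (grid a b m i.+1) *
      (half_diagram W (grid a b m i.+1) - half_diagram W (grid a b m i)))
    _ FU (grid_step_cvg0 a b (l * (b - a)))) => [m n|m|m].
  - exact: half_diagram_grid_sum.
  - exact: half_diagram_grid_sum.
  - apply: cvg_big => [|j _]; first exact: add_continuous.
    apply: cvgM; first exact: cvg_cst.
    by apply: cvgB; exact: hW.
have [L HL] := log_sum_charge xab.
pose S n := \sum_(i < n.+1) ln ((phi x - phi (c n i)) / (phi x - phi (d n i))).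
have IS : I (w n) - S n @[n --> U] --> 0.
  apply/norm_cvg0P; apply: (@squeeze_cvgr _ _ _ _ (cst 0)
    (fun n => L * ((b - a) / n.+1%:R))).
  - by apply: nearW => n; rewrite normr_ge0/=; exact: HL (cd n).
  - exact: cvg_cst.
  - by move=> A /(grid_step_cvg0 a b L); exact: ooU.
rewrite -/S (_ : S = fun n => I (w n) - (I (w n) - S n)).
  by rewrite -[X in _ --> X]subr0; exact: cvgB.
by apply/funext => n; rewrite subKr.
Qed.

End charge_sums.

(** * Diagrams *)

Lemma outside_itv (R : realDomainType) (a b s : R) :
  Num.max `|a| `|b| < `|s| -> ~~ (a <= s <= b).
Proof.
rewrite ltNge; apply: contra => /andP[as_ sb]; rewrite ler_norml lerNl !le_max.
apply/andP; split; apply/orP; [left|right].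
  by rewrite -normrN (le_trans _ (ler_norm _))// lerN2.
by rewrite (le_trans sb)// ler_norm.
Qed.

Lemma diagrams_ultrafilter_limit (R : realType) (a b : R) (U : set_system nat)
    (w : nat -> continual_diagram R) :
  UltraFilter U -> (forall n, diagrams a b (w n)) ->
  exists2 W : continual_diagram R, diagrams a b W &
    forall s, w n s @[n --> U] --> W s.
Proof.
move=> UU wab; have UP : ProperFilter U by exact: ultra_proper.
have aab : ~~ (a <= a - 1 <= b) by apply/negP => /andP[]; lra.
(* The centre is read off from the value of the diagram at a - 1, so the pointwise limit makes the
   centres converge as well. *)
pose c n := w n (a - 1) + (a - 1).
have cE n : a <= c n <= b /\
    forall s, ~~ (a <= s <= b) -> w n s = `|s - c n|.
  have [s0 [/andP[as0 s0b] ws0]] := wab n.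
  suff -> : c n = s0 by rewrite as0 s0b.
  by rewrite /c ws0// distrC ger0_norm ?subrK// subr_ge0; lra.
have /choice[f fE] s : exists l : R, w n s @[n --> U] --> l.
  pose M := `|s - (a - 1)|.
  apply: (ultrafilter_bounded_cvg UU (m := 1 - M) (M := b - a + 1 + M)) => n.
  have := diagram_lipschitz (w n) s (a - 1); rewrite -/M ler_norml => /andP[h1 h2].
  have [/andP[h3 h4] _] := cE n; rewrite /c in h3 h4.
  by apply/andP; split; lra.
have f_lip s t : `|f s - f t| <= `|s - t|.
  apply: (@cvgr_to_le nat U _ _ (fun n => `|w n s - w n t|)).
    by apply: cvg_norm; exact: cvgB (fE s) (fE t).
  by apply: nearW => n; exact: diagram_lipschitz.
pose s0 := f (a - 1) + (a - 1).
have cs0 : c n @[n --> U] --> s0.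
  by apply: cvgD; [exact: fE|exact: cvg_cst].
have fs0 s : ~~ (a <= s <= b) -> f s = `|s - s0|.
  move=> sab; apply: (cvg_unique _ (fE s)) => //.
  rewrite (_ : (fun n => w n s) = (fun n => `|s - c n|)).
    by apply: cvg_norm; apply: cvgB => //; exact: cvg_cst.
  by apply/funext => n; have [_ ->] := cE n.
have f_inf : exists s1 M, forall s, M < `|s| -> f s = `|s - s1|.
  exists s0, (Num.max `|a| `|b|) => s sM; apply: fs0.
  exact: outside_itv.
exists (ContinualDiagram f_lip f_inf) => //.
exists s0; split => //; apply/andP; split.
  apply: (@cvgr_to_ge nat U _ _ _ _ _ cs0); apply: nearW => n.
  by have [/andP[]] := cE n.
apply: (@cvgr_to_le nat U _ _ _ _ _ cs0); apply: nearW => n.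
by have [/andP[]] := cE n.
Qed.

(** F is piecewise linear, with slope d_i divided by the mesh on the i-th cell, 0 to the left of a
    and 1 to the right of b. Slopes in [0, 1] for F amount to the 1-Lipschitz condition for 2 F s -
    s + s0. *)
Lemma interpolating_diagram (R : realType) (a b : R) (n : nat) (d : nat -> R) :
  a < b -> (forall i, (i <= n)%N -> 0 <= d i <= (b - a) / n.+1%:R) ->
  exists2 w : continual_diagram R, diagrams a b w &
    forall i, (i <= n)%N ->
      half_diagram w (grid a b n i.+1) - half_diagram w (grid a b n i) = d i.
Proof.
move=> ab; have := grid_step_gt0 ab n; have := gridS a b n.
have : \sum_(i < n.+1) ((b - a) / n.+1%:R) = b - a.
  by rewrite sumr_const card_ord -[LHS]mulr_natl mulrCA divff ?pnatr_eq0// mulr1.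
move: (_ / _) => h sumh; set t := grid a b n => tS h0 d01.
have th (i : 'I_n.+1) : 0 <= d i / h <= 1.
  have /andP[d0 d1] := d01 i (ltn_ord i).
  by rewrite divr_ge0 ?(ltW h0)//= ler_pdivrMr// mul1r.
have t0 : t 0%N = a by exact: grid_start.
have tn : t n.+1 = b by exact: grid_end.
(* [E i s] is the length of the part of [t i, t i.+1] to the left of [s]. *)
pose E i s := h + Num.max s (t i) - Num.max s (t i.+1).
have E_nd i s u : s <= u -> E i s <= E i u.
  rewrite /E tS => su.
  case: (leP s (t i)) => ?; case: (leP u (t i)) => ?;
    by case: (leP s (t i + h)) => ?; case: (leP u (t i + h)) => ?; lra.
have sumE s : \sum_(i < n.+1) E i s = b - a + Num.max s a - Num.max s b.
  have := telescope_sumr (fun i => - Num.max s (t i)) (leq0n n.+1).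
  rewrite big_mkord t0 tn => tel.
  rewrite [RHS](_ : _ = \sum_(i < n.+1) h + (- Num.max s b - - Num.max s a)).
    by rewrite -tel -big_split; apply: eq_bigr => i _ /=; rewrite /E; ring.
  by rewrite sumh; ring.
pose F s := \sum_(i < n.+1) d i / h * E i s + (Num.max s b - b).
have F_lip s u : s <= u -> 0 <= F u - F s <= u - s.
  move=> su.
  have FB : F u - F s = \sum_(i < n.+1) d i / h * (E i u - E i s) +
      (Num.max u b - Num.max s b).
    rewrite /F; under [in RHS]eq_bigr do rewrite mulrBr.
    by rewrite sumrB; ring.
  have mB : 0 <= Num.max u b - Num.max s b.
    by case: (leP u b) => ?; case: (leP s b) => ?; lra.
  rewrite FB; apply/andP; split.
    rewrite addr_ge0// sumr_ge0// => i _; rewrite mulr_ge0 ?subr_ge0 ?E_nd//.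
    by have /andP[] := th i.
  apply: (@le_trans _ _ (\sum_(i < n.+1) (E i u - E i s) +
      (Num.max u b - Num.max s b))).
    rewrite lerD2r; apply: ler_sum => i _; rewrite ler_piMl ?subr_ge0 ?E_nd//.
    by have /andP[] := th i.
  rewrite sumrB !sumE; case: (leP u b) => ?; case: (leP s b) => ?;
    by case: (leP u a) => ?; case: (leP s a) => ?; lra.
pose S := \sum_(i < n.+1) d i.
have S01 : 0 <= S <= b - a.
  apply/andP; split.
    by apply: sumr_ge0 => i _; have /andP[] := d01 i (ltn_ord i).
  by rewrite -sumh; apply: ler_sum => i _; have /andP[] := d01 i (ltn_ord i).
have tab (i : 'I_n.+1) : [/\ a <= t i, t i <= b, a <= t i.+1 & t i.+1 <= b].
  have /andP[? ?] := grid_itv ab (ltnW (ltn_ord i)).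
  by have /andP[? ?] := grid_itv ab (ltn_ord i).
have Fa s : s <= a -> F s = 0.
  move=> sa; rewrite /F big1 => [|i _].
    by rewrite max_r ?subrr ?addr0//; lra.
  have [? ? ? ?] := tab i; rewrite /E !max_r ?(le_trans sa)// tS.
  by rewrite [X in _ * X](_ : _ = 0) ?mulr0//; ring.
have Fb s : b <= s -> F s = S + (s - b).
  move=> bs; rewrite /F max_l//; congr (_ + _); apply: eq_bigr => i _.
  have [? ? ? ?] := tab i; rewrite /E !max_l ?(le_trans _ bs)//.
  by rewrite addrK divfK// gt_eqF.
(* The centre is forced: to the right of b, F s = S + s - b, and 2 F s - s + s0 = s - s0 gives s0 =
   b - S. *)
pose s0 := b - S; pose f s := F s *+ 2 - s + s0.
have f_lip s u : `|f s - f u| <= `|s - u|.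
  wlog su : s u / s <= u.
    by move=> H; have [/H//|/ltW/H] := leP s u; rewrite distrC (distrC u).
  rewrite distrC (distrC s) [leRHS]ger0_norm ?subr_ge0//.
  have /andP[? ?] := F_lip _ _ su.
  by rewrite ler_norml /f !mulr2n; apply/andP; split; lra.
have /andP[S0 S1] := S01.
have fs0 s : ~~ (a <= s <= b) -> f s = `|s - s0|.
  rewrite negb_and -!ltNge => /orP[sa|bs].
    by rewrite /f Fa ?ltW// ltr0_norm /s0; lra.
  by rewrite /f Fb ?ltW// ger0_norm /s0; lra.
have f_inf : exists s1 M, forall s, M < `|s| -> f s = `|s - s1|.
  exists s0, (Num.max `|a| `|b|) => s sM; apply: fs0.
  exact: outside_itv.
exists (ContinualDiagram f_lip f_inf).
  by exists s0; split => //; rewrite /s0; lra.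
move=> j jn; rewrite /half_diagram /= -/t.
have Et i : E i (t j.+1) - E i (t j) = if i == j then h else 0.
  rewrite /E; have [ij|ji|->] := ltngtP i j.
  - have ij1 := ltnW ij; have ij2 := leqW ij1.
    by rewrite !max_l ?grid_le ?ltnS//; ring.
  - have ji1 := ltnW ji; have ji2 := leqW ji1.
    by rewrite !max_r ?grid_le ?ltnS//; ring.
  - have tjj : t j <= t j.+1 by rewrite grid_le.
    by rewrite (max_l tjj) !maxxx (max_r tjj) tS; ring.
have tj : t j.+1 <= b by have /andP[] := grid_itv ab (jn : (j.+1 <= n.+1)%N).
have tj' : t j <= b by have /andP[] := grid_itv ab (leqW jn).
have -> : d j = F (t j.+1) - F (t j).
  rewrite /F !max_r// subrr !addr0 -sumrB.
  have jn1 : (j < n.+1)%N by [].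
  rewrite (bigD1 (Ordinal jn1))//= -mulrBr Et eqxx divfK ?gt_eqF//.
  rewrite big1 ?addr0// => i /eqP ij; rewrite -mulrBr Et.
  by case: eqP => [ij'|_]; [case: ij; exact: val_inj|rewrite mulr0].
by rewrite /f !mulr2n; field.
Qed.

(** * Existence *)

Section existence.
Variables (R : realType) (a b : R) (phi al : R -> R) (be : R).
Hypotheses (ab : a < b) (ker : cauchy_kernel a b phi al be).

Let charge_transform (w : continual_diagram R) x := (phi x - phi b)^-1 *
  expR (- \int[lebesgue_stieltjes_measure (half_diagram w)]_(s in `[a, b])
            (al x / (phi x - phi s) - be)).

Lemma exists_measure_of_diagram (w : continual_diagram R) :
  exists2 mu : probability (measurableTypeR R) R, prob_measures a b mu &
    forall x, ~~ (a <= x <= b) ->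
      \int[mu]_(s in `[a, b]) (phi x - phi s)^-1 = charge_transform w x.
Proof.
have [U [UU ooU]] := ultraFilterLemma (eventually_filter).
have UP : ProperFilter U by exact: ultra_proper.
pose t n i := grid a b n i.
(* The mass of each cell is placed at its right end, on [c n i, t n i.+1]. The poles c_i and zeros
   t_{i+1} then interlace, and the last zero t_{n+1} = b cancels against the prefactor 1 / (phi x -
   phi b). *)
pose c n i := t n i.+1 - (half_diagram w (t n i.+1) - half_diagram w (t n i)).
have cd n i : (i <= n)%N -> [/\ t n i <= c n i, c n i <= t n i.+1,
    t n i.+1 <= t n i.+1 & t n i.+1 - c n i =
    half_diagram w (t n i.+1) - half_diagram w (t n i)].
  move=> _; have := half_diagram_lipschitz w (ltW (grid_ltS ab n i)).
  by rewrite -/(t n i) -/(t n i.+1) /c => /andP[? ?]; split; lra.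
have cab n i : (i <= n)%N -> a <= c n i <= b.
  move=> ilt; have [ti ti1 _ _] := cd n i ilt.
  have /andP[ai _] := grid_itv ab (leqW ilt).
  have /andP[_ ib] := grid_itv ab (ilt : (i.+1 <= n.+1)%N).
  by rewrite (le_trans ai)// (le_trans ti1).
have tab n i : (i <= n)%N -> a <= t n i.+1 <= b.
  by move=> ilt; exact: grid_itv.
have /choice[p pE] n : exists p : nat -> R,
    [/\ forall i, 0 <= p i, \sum_(i < n.+1) p i = 1 &
     forall x, ~~ (a <= x <= b) ->
       \sum_(i < n.+1) p i * (phi x - phi (c n i))^-1 = (phi x - phi b)^-1 *
       expR (- \sum_(i < n.+1)
         ln ((phi x - phi (c n i)) / (phi x - phi (t n i.+1))))].
  have [i ilt|p [p0 p1] pE] := @partial_fractions_interlacing R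
      (fun i => phi (c n i)) (fun i => phi (t n i.+1)) n.
    have [_ ct _ _] := cd n i (ltnW ilt); have [tc _ _ _] := cd n i.+1 ilt.
    by rewrite !(kernel_le ker).
  exists p; split => // x xab; rewrite pE => [|i ilt]; last first.
    by rewrite -subr_eq0 (kernel_neq ker xab)// cab.
  rewrite -(prod_ratioE (n := n.+1) (c := c n) (d := fun i => t n i.+1) ker xab
    (cab n) (tab n)) big_ord_recr /= /t grid_end.
  have := kernel_neq ker xab (cab n n (leqnn n)) => zc.
  have zb : phi x - phi b != 0 by rewrite (kernel_neq ker xab)// lexx ltW.
  by field; rewrite zc zb.
have [|||mu muab muE] := discrete_weak_limit UU ab (p := p) (c := c).
- by move=> n i; have [] := pE n.
- by move=> n; have [] := pE n.
- by move=> n i ilt; rewrite in_itv/= cab.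
exists mu => // x xab.
have [l Cl] := cauchy_nondecreasing_lipschitz ab ker xab.
apply: (cvg_unique _ (muE _ l Cl)) => //.
rewrite (_ : (fun n => _) = (fun n => (phi x - phi b)^-1 *
    expR (- \sum_(i < n.+1)
      ln ((phi x - phi (c n i)) / (phi x - phi (t n i.+1)))))); last first.
  by apply/funext => n; have [_ _ ->] := pE n.
rewrite /charge_transform; apply: cvgM; first exact: cvg_cst.
apply: continuous_cvg; first exact: continuous_expR.
apply: cvgN.
exact: (@log_sum_cvg _ _ _ ab _ _ _ ker x (fun=> w) w U c (fun n i => t n i.+1)
  xab _ ooU (fun s => cvg_cst _) cd).
Qed.

Lemma exists_diagram_of_measure (mu : probability (measurableTypeR R) R) :
  prob_measures a b mu ->
  exists2 w : continual_diagram R, diagrams a b w &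
    forall x, ~~ (a <= x <= b) ->
      \int[mu]_(s in `[a, b]) (phi x - phi s)^-1 = charge_transform w x.
Proof.
move=> muab; have [U [UU ooU]] := ultraFilterLemma (eventually_filter).
have UP : ProperFilter U by exact: ultra_proper.
pose t n i := grid a b n i.
have tab n i : (i <= n.+1)%N -> a <= t n i <= b by exact: grid_itv.
pose H u := fine (mu `[a, u]%classic).
have Hb : H b = 1 by rewrite /H [X in fine X]muab.
have Hnd u v : u <= v -> H u <= H v.
  move=> uv; rewrite fine_le ?fin_num_measure//.
  by apply: le_measure; rewrite ?inE//; exact: subset_itvl.
(* The uniform part [e] makes all the weights positive. *)
pose e n : R := n.+2%:R^-1.
have e0 n : 0 < e n by rewrite invr_gt0 ltr0n.
have e1 n : e n <= 1 by rewrite invf_le1 ?ltr0n// ler1n.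
(* The mass of each half-open cell is moved to its right node; the node 0 receives the possible atom
   at [a]. There are n + 2 nodes. *)
pose m n i := if i is j.+1 then H (t n j.+1) - H (t n j) else H a.
have m0 n i : 0 <= m n i.
  case: i => [|i]; first exact: fine_ge0.
  by rewrite /m subr_ge0 Hnd// ltW// grid_ltS.
have sum_m n (f : R -> R) :
    \sum_(i < n.+2) m n i * f (t n i) = grid_sum a b n f H.
  rewrite grid_sum_parts big_ord_recl /= /t grid_start mulrC; congr (_ + _).
  by apply: eq_bigr => i _; rewrite mulrC.
(* A uniform measure of total mass [e n] on the n + 2 nodes gives each of them [e n] divided by n +
   2, that is [e n ^+ 2]. *)
pose p n i := (1 - e n) * m n i + e n ^+ 2.
have p0 n i : 0 < p n i.
  by rewrite ltr_wpDl ?exprn_gt0// mulr_ge0// subr_ge0.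
have sum_p n (f : R -> R) : \sum_(i < n.+2) p n i * f (t n i) =
    grid_sum a b n f H + e n * (e n * \sum_(i < n.+2) f (t n i) -
                                grid_sum a b n f H).
  under eq_bigr do rewrite mulrDl -mulrA.
  rewrite big_split /= -!mulr_sumr sum_m; ring.
have p1 n : \sum_(i < n.+2) p n i = 1.
  have := sum_p n (fun=> 1); under eq_bigr do rewrite mulr1.
  move=> ->; rewrite sumr_const card_ord -[1 *+ _]/(n.+2%:R) mulVf ?pnatr_eq0//.
  rewrite /grid_sum Hb big1 => [|i _]; last by rewrite subrr mul0r.
  by rewrite mulr1 subr0 subrr mulr0 addr0.
have /choice[d dE] n : exists d : nat -> R,
    (forall i, (i <= n)%N -> t n i <= d i <= t n i.+1) /\
    forall x, ~~ (a <= x <= b) ->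
      \sum_(i < n.+2) p n i * (phi x - phi (t n i))^-1 = (phi x - phi b)^-1 *
      expR (- \sum_(i < n.+1)
        ln ((phi x - phi (t n i)) / (phi x - phi (d i)))).
  have [i _|i _|y ty yE] := @factor_positive_fractions R (fun i => phi (t n i))
      (p n) n.+1.
  - exact/(kernel_lt ker)/grid_ltS.
  - exact: p0.
  (* The factorisation takes place in the variable phi; continuity of phi pulls each zero back to a
     point of the corresponding cell. Indices beyond [n] get the dummy value 0. *)
  have /choice[d dE] i : exists d, (i <= n)%N ->
      t n i <= d <= t n i.+1 /\ phi d = y i.
    have [ilt|nlt] := leqP i n; last by exists 0.
    have ti := grid_ltS ab n i.
    have [||u uab uE] := IVT (ltW ti) (v := y i) (f := phi).
    - exact/continuous_subspaceT/(kernel_continuous ker).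
    - by rewrite ge_min le_max; have /andP[-> ->] := ty i ilt; rewrite orbT.
    by exists u => _; rewrite uE; split => //; move: uab; rewrite in_itv.
  exists d; split=> [i ilt|x xab]; first by have [] := dE i ilt.
  have dab i : (i < n.+1)%N -> a <= d i <= b.
    move=> ilt; have [/andP[td dt] _] := dE i ilt.
    have /andP[ai _] := tab n i (ltnW ilt); have /andP[_ ib] := tab n i.+1 ilt.
    by rewrite (le_trans ai)// (le_trans dt).
  rewrite yE => [|i ilt]; last by rewrite -subr_eq0 (kernel_neq ker xab)// tab.
  rewrite p1 mul1r /t grid_end; congr (_ * _).
  rewrite -(prod_ratioE ker xab (fun i ilt => tab n i (ltnW ilt)) dab).
  by apply: eq_bigr => i _; have [_ ->] := dE i (ltn_ord i).
(* A diagram that puts on each cell the Lebesgue length of [t_i, d_i]: its charge transform then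
   agrees with the finite product up to the mesh. *)
have /choice[w wE] n : exists w : continual_diagram R, diagrams a b w /\
    forall i, (i <= n)%N -> half_diagram w (t n i.+1) - half_diagram w (t n i) =
      d n i - t n i.
  have [i ilt|w wab wE] := @interpolating_diagram R a b n
    (fun i => d n i - t n i) ab.
    have [/(_ i ilt)/andP[td dt] _] := dE n.
    by rewrite subr_ge0 td/= -(grid_step a b n i) lerD2r.
  by exists w.
have [W Wab wW] := diagrams_ultrafilter_limit UU (fun n => (wE n).1).
exists W => // x xab; pose C s := (phi x - phi s)^-1.
have [l Cl] := cauchy_nondecreasing_lipschitz ab ker xab.
have cvgC : \sum_(i < n.+2) p n i * C (t n i) @[n --> U] -->
    \int[mu]_(s in `[a, b]) C s.
  pose M := `|C a| + `|C b|.
  have CM s : a <= s <= b -> `|C s| <= M.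
    move=> /andP[as_ sb]; have /andP[C1 _] := Cl _ _ (lexx a) as_ sb.
    have /andP[C2 _] := Cl _ _ as_ sb (lexx b); rewrite -!/(C _) in C1 C2.
    have := ler_norm (C b); have := ler_norm (- C a); rewrite normrN.
    have := normr_ge0 (C a); have := normr_ge0 (C b).
    by move=> ? ? ? ?; rewrite ler_norml /M; apply/andP; split; lra.
  have sumM n : `|e n * (\sum_(i < n.+2) C (t n i)) - grid_sum a b n C H| <=
      M + M.
    apply: le_trans (ler_normB _ _) _; apply: lerD.
      rewrite normrM gtr0_norm// mulrC ler_pdivrMr ?ltr0n//.
      apply: le_trans (ler_norm_sum _ _ _) _.
      rewrite mulr_natr -[X in _ *+ X]card_ord -sumr_const.
      by apply: ler_sum => i _; apply: CM; apply: tab; exact: (ltn_ord i).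
    rewrite -sum_m; apply: le_trans (ler_norm_sum _ _ _) _.
    have -> : M = \sum_(i < n.+2) m n i * M.
      have := sum_m n (fun=> M) => ->.
      rewrite /grid_sum Hb mulr1 big1 ?subr0// => i _.
      by rewrite subrr mul0r.
    apply: ler_sum => i _; rewrite normrM ger0_norm// ler_wpM2l//.
    by apply: CM; apply: tab; exact: (ltn_ord i).
  suff : \sum_(i < n.+2) p n i * C (t n i) @[n --> \oo] -->
      \int[mu]_(s in `[a, b]) C s by move=> cv A /cv; exact: ooU.
  rewrite (funext (fun n => sum_p n C)).
  rewrite -[X in _ --> X]addr0; apply: cvgD.
    apply/subr_cvg0/norm_cvg0P.
    apply: (@squeeze_cvgr _ _ _ _ (cst 0) (fun n => l * ((b - a) / n.+1%:R))).
    - apply: nearW => n; rewrite normr_ge0/= distrC.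
      have mufin : (mu `[a, b]%classic < +oo)%E.
        by rewrite [X in (X < _)%E]muab ltry.
      have := @Rintegral_grid_sum _ _ _ C mu ab
        (nondecreasing_lipschitz_homo Cl) mufin n _
        (fun j jm => (andP (nondecreasing_lipschitz_grid ab Cl jm)).2).
      by rewrite -/H -/(H b) Hb mulr1.
    - exact: cvg_cst.
    - exact: grid_step_cvg0.
  apply/norm_cvg0P.
  apply: (@squeeze_cvgr _ _ _ _ (cst 0) (fun n => n.+1%:R^-1 * (M + M))).
  - apply: nearW => n; rewrite normr_ge0/= normrM gtr0_norm//.
    apply: ler_pM => //; first exact/ltW.
    by rewrite lef_pV2 ?posrE ?ltr0n// ler_nat.
  - exact: cvg_cst.
  - rewrite -[X in _ --> X](mul0r (M + M)); apply: cvgM; last exact: cvg_cst.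
    exact: cvg_harmonic.
apply: (cvg_unique _ cvgC) => //.
rewrite (_ : (fun n => _) = (fun n => (phi x - phi b)^-1 *
    expR (- \sum_(i < n.+1)
      ln ((phi x - phi (t n i)) / (phi x - phi (d n i)))))); last first.
  by apply/funext => n; have [_ ->] := dE n.
rewrite /charge_transform; apply: cvgM; first exact: cvg_cst.
apply: continuous_cvg; first exact: continuous_expR.
apply: cvgN.
apply: (@log_sum_cvg _ _ _ ab _ _ _ ker x w W U t d xab _ ooU wW) => n i ilt.
have [/(_ i ilt)/andP[td dt] _] := dE n.
by split => //; have [_ ->] := wE n.
Qed.

End existence.

(** * Injectivity of the Stieltjes transform *)

Lemma bernoulli_le (R : realDomainType) (y : R) (n : nat) : 0 <= y <= 1 ->
  1 - n%:R * y <= (1 - y) ^+ n.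
Proof.
move=> /andP[y0 y1]; elim: n => [|n IHn]; first by rewrite mul0r subr0 expr0.
rewrite exprS (le_trans _ (ler_wpM2l _ IHn)) ?subr_ge0// -natr1.
have : 0 <= n%:R * (y * y) by rewrite mulr_ge0// mulr_ge0.
by rewrite -subr_ge0 => h; rewrite -subr_ge0; move: h; congr (0 <= _); ring.
Qed.

(** From n y <= (1 + y)^n and (1 + y)^n (1 - y)^n = (1 - y^2)^n <= 1. *)
Lemma bernoulli_ge (R : realDomainType) (y : R) (n : nat) : 0 <= y <= 1 ->
  n%:R * y * (1 - y) ^+ n <= 1.
Proof.
move=> /andP[y0 y1]; have le1 : (1 + y) ^+ n * (1 - y) ^+ n <= 1.
  rewrite -exprMn exprn_ile1//.
    by rewrite mulr_ge0 ?subr_ge0// addr_ge0.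
  rewrite -subr_ge0 (_ : _ - _ = y * y) ?mulr_ge0//; ring.
apply: le_trans le1; rewrite ler_wpM2r ?exprn_ge0 ?subr_ge0//.
suff: 1 + n%:R * y <= (1 + y) ^+ n by apply: le_trans; rewrite lerDr.
elim: n => [|n IHn]; first by rewrite mul0r addr0 expr0.
rewrite exprS (le_trans _ (ler_wpM2l _ IHn)) ?addr_ge0// -natr1.
have : 0 <= n%:R * (y * y) by rewrite mulr_ge0// mulr_ge0.
by rewrite -subr_ge0 => h; rewrite -subr_ge0; move: h; congr (0 <= _); ring.
Qed.

(** A variant of the polynomials (1 - v^n)^(2^n) from the elementary proof of the Stone-Weierstrass
    theorem, which tend to 1/e at v = 1/2. With the present exponents, the product of 2^(n (n + 1))
    and v^((n + 1)^2) is at most 2^(-(n + 1)) for v <= 1/2, the point 1/2 included. It equals (v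
    (2v)^n)^(n + 1), eventually at least 2^(n + 1), for v > 1/2. The two Bernoulli bounds turn this
    into the limits 1 and 0. *)
Definition threshold {R : realType} (n : nat) (v : R) : R :=
  (1 - v ^+ (n.+1 * n.+1)) ^+ (2 ^ (n.+1 * n)).

Section threshold_theory.
Variables (R : realType) (v : R).
Hypothesis v01 : 0 <= v <= 1.

Let vX n : 0 <= v ^+ n <= 1.
Proof. by have /andP[v0 v1] := v01; rewrite exprn_ge0//= exprn_ile1. Qed.

Lemma threshold_itv n : 0 <= threshold n v <= 1.
Proof.
have /andP[v0 v1] := vX (n.+1 * n.+1).
by rewrite /threshold exprn_ge0 ?subr_ge0//= exprn_ile1 ?subr_ge0// gerBl.
Qed.

Lemma cvg_threshold : threshold n v @[n --> \oo] --> ((v <= 2^-1)%R%:R : R).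
Proof.
have /andP[v0 v1] := v01.
have geom : (2^-1 : R) ^+ n @[n --> \oo] --> 0.
  by apply: cvg_expr; rewrite ger0_norm ?invr_ge0// invf_lt1// ltr1n.
have geom1 : (2^-1 : R) ^+ n.+1 @[n --> \oo] --> 0.
  by have := geom; rewrite -(cvg_shiftS (fun n => (2^-1 : R) ^+ n)).
have [vle|vgt] := leP v 2^-1.
  rewrite -[X in _ --> X](subr0 (1 : R)).
  apply: (@squeeze_cvgr _ _ _ _ (fun n => 1 - (2^-1 : R) ^+ n.+1) (cst 1)).
  - apply: nearW => n; have /andP[_ ->] := threshold_itv n; rewrite andbT.
    apply: le_trans (bernoulli_le _ (vX _)); rewrite lerD2l lerN2 natrX.
    apply: (@le_trans _ _ (2 ^+ (n.+1 * n) * 2^-1 ^+ (n.+1 * n.+1))).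
      by rewrite ler_wpM2l ?exprn_ge0// lerXn2r ?nnegrE ?invr_ge0.
    by rewrite mulnS exprD mulrCA -exprMn divff ?expr1n ?mulr1.
  - by apply: cvgB => //; exact: cvg_cst.
  - by rewrite subr0; exact: cvg_cst.
apply: (@squeeze_cvgr _ _ _ _ (cst 0) (fun n => (2^-1 : R) ^+ n.+1)) => //.
  have : \forall n \near \oo, 2 <= v * (2 * v) ^+ n.
    have vv0 : 0 < v by apply: lt_trans vgt; rewrite invr_gt0.
    have w1 : 1 < 2 * v by rewrite mulrC -ltr_pdivrMr// div1r.
    have w0 : 0 < 2 * v by exact: lt_trans w1.
    have geomv : (2 * v)^-1 ^+ n @[n --> \oo] --> 0.
      by apply: cvg_expr; rewrite gtr0_norm ?invr_gt0// invf_lt1.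
    have v2 : 0 < v / 2 by rewrite divr_gt0.
    have : \forall n \near \oo, (2 * v)^-1 ^+ n <= v / 2.
      exact: cvgr_le geomv _ v2.
    apply: filterS => n; rewrite exprVn -div1r ler_pdivrMr ?exprn_gt0//.
    by rewrite mulrAC ler_pdivlMr// mul1r.
  apply: filterS => n vn; have /andP[-> _] := threshold_itv n => /=.
  have := bernoulli_ge (2 ^ (n.+1 * n)) (vX (n.+1 * n.+1)).
  rewrite -/(threshold n v) natrX => h.
  rewrite exprVn -div1r ler_pdivlMr ?exprn_gt0// mulrC.
  apply: le_trans h; rewrite ler_wpM2r//; first by have /andP[] := threshold_itv n.
  rewrite (mulnC n.+1 n) !exprM -exprMn lerXn2r ?nnegrE//.
    by rewrite mulr_ge0 ?exprn_ge0.
  by apply: le_trans vn _; rewrite exprMn exprS mulrCA.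
exact: cvg_cst.
Qed.

End threshold_theory.

Section stieltjes_uniqueness.
Variables (R : realType) (a b : R) (phi : R -> R).
Variables mu nu : {measure set (measurableTypeR R) -> \bar R}.
Hypotheses (ab : a < b) (phi_lt : {homo phi : s t / s < t}).
Hypothesis phi_unbounded : forall M, exists2 x, b < x & M < phi x.
Hypotheses (mufin : (mu `[a, b]%classic < +oo)%E)
           (nufin : (nu `[a, b]%classic < +oo)%E).

Let bounded_measurable (g : R -> R) :=
  measurable_fun (`[a, b] : set R) g /\
  exists M : R, forall s, s \in `[a, b] -> `|g s| <= M.

Let same_integral (g : R -> R) :=
  \int[mu]_(s in `[a, b]) g s = \int[nu]_(s in `[a, b]) g s.

Let same_transform (g : R -> R) :=
  forall x, b < x -> same_integral (fun s => g s / (phi x - phi s)).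

Let integrable_mu g : bounded_measurable g ->
  mu.-integrable `[a, b] (EFin \o g).
Proof. by move=> [mg [M gM]]; exact: bounded_measurable_integrable gM. Qed.

Let integrable_nu g : bounded_measurable g ->
  nu.-integrable `[a, b] (EFin \o g).
Proof. by move=> [mg [M gM]]; exact: bounded_measurable_integrable gM. Qed.

Let phi_le s t : s <= t -> phi s <= phi t.
Proof. by rewrite le_eqVlt => /predU1P[->//|/phi_lt/ltW]. Qed.

Let phi_bm : bounded_measurable phi.
Proof.
split; first by apply: nondecreasing_in_measurable => s t _ _; exact: phi_le.
exists (`|phi a| + `|phi b|) => s; rewrite in_itv/= => /andP[/phi_le as_ /phi_le sb].
have := ler_norm (phi b); have := ler_norm (- phi a); rewrite normrN.
have := normr_ge0 (phi a); have := normr_ge0 (phi b).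
by move=> ? ? ? ?; rewrite ler_norml; apply/andP; split; lra.
Qed.

Let cst_bm (c : R) : bounded_measurable (fun=> c).
Proof. by split; [exact: measurable_cst|exists `|c|]. Qed.

Let add_bm f g : bounded_measurable f -> bounded_measurable g ->
  bounded_measurable (fun s => f s + g s).
Proof.
move=> [mf [M fM]] [mg [N gN]]; split; first exact: measurable_funD.
exists (M + N) => s sab; apply: le_trans (ler_normD _ _) _.
by rewrite lerD ?fM ?gN.
Qed.

Let mul_bm f g : bounded_measurable f -> bounded_measurable g ->
  bounded_measurable (fun s => f s * g s).
Proof.
move=> [mf [M fM]] [mg [N gN]]; split; first exact: measurable_funM.
by exists (M * N) => s sab; rewrite normrM ler_pM ?fM ?gN.
Qed.

Let cauchy_bm x : b < x -> bounded_measurable (fun s => (phi x - phi s)^-1).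
Proof.
move=> bx; have px s : s <= b -> 0 < phi x - phi s.
  by move=> sb; rewrite subr_gt0 phi_lt// (le_lt_trans sb).
split.
  apply: nondecreasing_in_measurable => s t; rewrite !in_itv/=.
  move=> /andP[_ sb] /andP[_ tb] st.
  by rewrite lef_pV2 ?posrE ?px// lerD2l lerN2 phi_le.
exists (phi x - phi b)^-1 => s; rewrite in_itv/= => /andP[_ sb].
by rewrite gtr0_norm ?invr_gt0 ?px// lef_pV2 ?posrE ?px// lerD2l lerN2 phi_le.
Qed.

Let same_integral_lin c f g : bounded_measurable f -> bounded_measurable g ->
  same_integral f -> same_integral g -> same_integral (fun s => c * f s + g s).
Proof.
move=> bf bg sf sg; rewrite /same_integral.
have bcf := mul_bm (cst_bm c) bf.
rewrite !RintegralD//; [|exact: integrable_nu|exact: integrable_nu|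
  exact: integrable_mu|exact: integrable_mu].
rewrite !RintegralZl//; [|exact: integrable_nu|exact: integrable_mu].
by rewrite sf sg.
Qed.

Let eq_same_integral f g : {in `[a, b], f =1 g} ->
  same_integral f -> same_integral g.
Proof.
move=> fg; have fgS : {in `[a, b]%classic, f =1 g}.
  by move=> s; rewrite inE => sab; exact: fg.
by rewrite /same_integral (@eq_Rintegral _ _ _ mu _ _ _ fgS)
  (@eq_Rintegral _ _ _ nu _ _ _ fgS).
Qed.

(** The integrand of the difference is - g s phi s / (phi x - phi s). Hence phi x times the
    transform of [g] tends to the integral of [g] as phi x grows, and the transform determines the
    integral. *)
Let transform_estimate (m : {measure set (measurableTypeR R) -> \bar R})
    (g : R -> R) (M x : R) :
  (m `[a, b]%classic < +oo)%E -> bounded_measurable g -> b < x ->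
  (forall s, s \in `[a, b] -> `|g s * phi s| <= M) ->
  `|\int[m]_(s in `[a, b]) g s -
    phi x * \int[m]_(s in `[a, b]) (g s / (phi x - phi s))| <=
  M / (phi x - phi b) * fine (m `[a, b]%classic).
Proof.
move=> mfin bg bx gM.
have px s : s <= b -> 0 < phi x - phi s.
  by move=> sb; rewrite subr_gt0 phi_lt// (le_lt_trans sb).
have int_m f : bounded_measurable f -> m.-integrable `[a, b] (EFin \o f).
  by move=> [mf [N fN]]; exact: bounded_measurable_integrable fN.
have bgC := mul_bm bg (cauchy_bm bx).
have bxgC := mul_bm (cst_bm (phi x)) bgC.
rewrite -RintegralZl//; last exact: int_m.
rewrite -RintegralB//; [|exact: int_m|exact: int_m].
have bB := add_bm bg (mul_bm (cst_bm (-1)) bxgC).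
have bB' : bounded_measurable
    (fun s => g s - phi x * (g s / (phi x - phi s))).
  by under eq_fun do rewrite -mulN1r.
apply: le_trans (le_normr_Rintegral _ (int_m _ bB')) _ => //.
rewrite -Rintegral_cst//; apply: le_Rintegral => //.
- have [mB [N BN]] := bB'; apply: int_m; split; first exact: measurableT_comp.
  by exists N => s sab; rewrite normr_id BN.
- exact: int_m.
move=> s /= sab; have := sab; rewrite in_itv/= => /andP[_ sb].
rewrite (_ : _ - _ = - (g s * phi s) / (phi x - phi s)); last first.
  by field; rewrite gt_eqF ?px.
rewrite normrM normrN ler_pM ?gM// gtr0_norm ?invr_gt0 ?px//.
by rewrite lef_pV2 ?posrE ?px// lerD2l lerN2 phi_le.
Qed.

Let same_integral_of_transform g : bounded_measurable g ->
  same_transform g -> same_integral g.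
Proof.
move=> bg sg; have [_ [M gM]] := mul_bm bg phi_bm.
pose K := M * (fine (mu `[a, b]%classic) + fine (nu `[a, b]%classic)).
pose D := `|\int[mu]_(s in `[a, b]) g s - \int[nu]_(s in `[a, b]) g s|.
have DK x : b < x -> D * (phi x - phi b) <= K.
  move=> bx; have px : 0 < phi x - phi b by rewrite subr_gt0 phi_lt.
  have h1 := transform_estimate mufin bg bx gM.
  have := transform_estimate nufin bg bx gM.
  rewrite -(sg x bx) distrC => h2.
  rewrite -ler_pdivlMr// /K mulrAC mulrDr.
  by apply: le_trans (lerD h1 h2); rewrite -[D]/(`|_|) (le_trans _ (ler_normD _ _))//
    addrA subrK.
apply/eqP; rewrite -subr_eq0 -normr_eq0 -/D eq_le normr_ge0 andbT leNgt.
apply/negP => D0; have [x bx] := phi_unbounded (phi b + K / D).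
by rewrite -ltrBrDl ltr_pdivrMr// mulrC ltNge DK.
Qed.

(** Since g phi / (phi x - phi) = phi x g / (phi x - phi) - g, equality for [g] of transforms and of
    integrals gives equality of transforms for g phi. *)
Let same_transform_mul g : bounded_measurable g -> same_transform g ->
  same_transform (fun s => g s * phi s).
Proof.
move=> bg sg x bx.
have bgC := mul_bm bg (cauchy_bm bx).
have sgi := same_integral_of_transform bg sg.
have sgN : same_integral (fun s => -1 * g s + 0).
  by apply: same_integral_lin => //; rewrite /same_integral !Rintegral_cst ?mul0r.
have bgN := add_bm (mul_bm (cst_bm (-1)) bg) (cst_bm 0).
apply: eq_same_integral (same_integral_lin (phi x) bgC bgN (sg x bx) sgN).
move=> s; rewrite in_itv/= => /andP[_ sb].
have px : phi x - phi s != 0 by rewrite subr_eq0 gt_eqF// phi_lt// (le_lt_trans sb).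
by field.
Qed.

Let poly_bm (p : {poly R}) : bounded_measurable (fun s => p.[phi s]).
Proof.
elim/poly_ind: p => [|p c IHp].
  by under eq_fun do rewrite horner0; exact: cst_bm.
under eq_fun do rewrite hornerMXaddC.
by apply: add_bm (cst_bm c); exact: mul_bm phi_bm.
Qed.

Hypothesis same : same_transform (fun=> 1).

Let same_transform_poly (p : {poly R}) : same_transform (fun s => p.[phi s]).
Proof.
elim/poly_ind: p => [|p c IHp] x bx.
  apply: (@eq_same_integral (fun=> 0)) => [s _|].
    by rewrite horner0 mul0r.
  by rewrite /same_integral !Rintegral_cst ?mul0r.
have IH := same_transform_mul (poly_bm p) IHp bx.
have bC := cauchy_bm bx.
have := same_integral_lin c (mul_bm (cst_bm 1) bC)
  (mul_bm (mul_bm (poly_bm p) phi_bm) bC) (same bx) IH.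
by apply: eq_same_integral => s _; rewrite hornerMXaddC; ring.
Qed.

Lemma stieltjes_transform_inj t : a <= t <= b ->
  mu `[a, t]%classic = nu `[a, t]%classic.
Proof.
move=> /andP[at_ tb]; have pab : 0 < phi b - phi a by rewrite subr_gt0 phi_lt.
(* This slope keeps the affine image [v] of phi within distance 1/2 of its value 1/2 at [t], hence
   in [0, 1], and v s <= 1/2 holds exactly when s <= t. *)
pose c := (2 * (phi b - phi a))^-1.
have c0 : 0 < c by rewrite invr_gt0 mulr_gt0.
pose v s := 2^-1 + c * (phi s - phi t).
have v01 s : s \in `[a, b] -> 0 <= v s <= 1.
  rewrite in_itv/= => /andP[/phi_le pas /phi_le psb].
  have pt := phi_le at_; have pt' := phi_le tb.
  have cE : c * (phi b - phi a) = 2^-1.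
    by rewrite /c; field; rewrite gt_eqF.
  have : c * (phi s - phi t) <= c * (phi b - phi a).
    by rewrite ler_pM2l// lerB.
  have : c * (phi t - phi s) <= c * (phi b - phi a).
    by rewrite ler_pM2l// lerB.
  by rewrite cE /v => h1 h2; apply/andP; split; lra.
pose p n : {poly R} := (1 - ((2^-1)%:P + c *: ('X - (phi t)%:P)) ^+
  (n.+1 * n.+1)) ^+ (2 ^ (n.+1 * n)).
have pE n s : (p n).[phi s] = threshold n (v s).
  by rewrite /p /threshold /v !(hornerE, horner_exp).
pose f n s := ((p n).[phi s])%:E.
have v_le s : (v s <= 2^-1) = (s <= t).
  rewrite /v gerDl pmulr_rle0// subr_le0; apply/idP/idP; last exact: phi_le.
  by rewrite leNgt => h; rewrite leNgt; apply: contra h; exact: phi_lt.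
have key (m : {measure set (measurableTypeR R) -> \bar R}) :
    (m `[a, b]%classic < +oo)%E ->
    \int[m]_(s in `[a, b]) f n s @[n --> \oo]%E --> m `[a, t]%classic.
  move=> mfin.
  have -> : m `[a, t]%classic =
      (\int[m]_(s in `[a, b]) (\1_(`[a, t]) s)%:E)%E.
    rewrite integral_indic// setIidl//.
    by apply: subset_itvl; rewrite bnd_simp.
  have [||||| _ _ //] := @dominated_convergence _ _ _ m `[a, b]%classic
    (measurable_itv _) f (fun s => (\1_(`[a, t]) s)%:E) (fun=> 1%E).
  - by move=> n; apply/measurable_EFinP; have [] := poly_bm (p n).
  - by apply/measurable_EFinP; exact: measurable_indic.
  - apply: aeW => s sab; apply: cvg_EFin; first by apply: nearW.
    have -> : \1_(`[a, t]) s = (v s <= 2^-1)%R%:R :> R.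
      rewrite v_le indicE; congr (nat_of_bool _)%:R.
      apply/idP/idP; rewrite inE/= in_itv/=; first by case/andP.
      by move=> ->; move: sab; rewrite /= in_itv/= => /andP[->].
    rewrite (_ : _ \o _ = fun n => threshold n (v s)).
      exact: cvg_threshold (v01 s sab).
    by apply/funext => n; rewrite /= pE.
  - apply: (@bounded_measurable_integrable _ _ _ m mfin (fun=> 1) 1) => //.
    by move=> s _; rewrite normr1.
  - apply: aeW => s n sab; rewrite /f /= lee_fin pE.
    by have /andP[h0 h1] := threshold_itv (v01 s sab) n; rewrite ger0_norm.
apply: (cvg_unique _ (key mu mufin)) => //.
rewrite (_ : (fun n => _) = fun n => (\int[nu]_(s in `[a, b]) f n s)%E).
  exact: key.
apply/funext => n; have bp := poly_bm (p n).
have := same_integral_of_transform bp (@same_transform_poly (p n)).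
rewrite /same_integral /Rintegral => E; have {E} := congr1 EFin E.
rewrite !fineK//.
  by apply: integrable_fin_num => //; exact: integrable_nu.
by apply: integrable_fin_num => //; exact: integrable_mu.
Qed.

End stieltjes_uniqueness.

(** * The two kernels *)

(** The last hypothesis makes phi' - be phi constant, a linear equation solved by affine and by
    exponential functions. It also makes [al x / (phi x - phi u) - be] the negative of the
    derivative in u of ln ((phi x - phi u) / (phi x - phi t)); the mean value theorem and
    monotonicity in u then give [kernel_ln]. *)
Lemma cauchy_kernel_of_derivative (R : realType) (a b : R)
    (phi dphi al : R -> R) (be l : R) :
  {homo phi : s t / s < t} -> (forall s : R, is_derive s 1 phi (dphi s)) ->
  (forall s, a <= s <= b -> dphi s <= l) -> (forall x, 0 <= al x) ->
  (forall x s, dphi s = al x - be * (phi x - phi s)) ->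
  cauchy_kernel a b phi al be.
Proof.
move=> phi_lt dphiP dphil al0 dphiE.
have phi_le s t : s <= t -> phi s <= phi t.
  by rewrite le_eqVlt => /predU1P[->//|/phi_lt/ltW].
have phi_c : continuous phi.
  by move=> s; apply: differentiable_continuous; apply/derivable1_diffP.
split => //.
  exists l => s t as_ st tb.
  have [u uP ->] := MVT_segment st (fun u _ => dphiP u) (continuous_subspaceT phi_c).
  rewrite ler_wpM2r ?subr_ge0// dphil//; move: uP; rewrite in_itv/= => /andP[su ut].
  by rewrite (le_trans as_)// (le_trans ut).
move=> x s t xab as_ st tb.
have phi_neq u : a <= u -> u <= b -> phi x - phi u != 0.
  move=> au ub; rewrite subr_eq0; have [xu|ux|xu] := ltgtP x u.
  - by rewrite lt_eqF// phi_lt.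
  - by rewrite gt_eqF// phi_lt.
  - by move: xab; rewrite xu au ub.
have C_le u v : a <= u -> u <= v -> v <= b ->
    (phi x - phi u)^-1 <= (phi x - phi v)^-1.
  move=> au uv vb; move: xab; rewrite negb_and -!ltNge => /orP[xa|bx].
    have xu := lt_le_trans xa au; have xv := lt_le_trans xu uv.
    by rewrite lef_nV2 ?negrE ?subr_lt0 ?phi_lt// lerD2l lerN2 phi_le.
  have vx := le_lt_trans vb bx; have ux := le_lt_trans uv vx.
  by rewrite lef_pV2 ?posrE ?subr_gt0 ?phi_lt// lerD2l lerN2 phi_le.
have r0 u v : a <= u -> u <= b -> a <= v -> v <= b ->
    0 < (phi x - phi u) / (phi x - phi v).
  move=> au ub av vb; move: xab; rewrite negb_and -!ltNge => /orP[xa|bx].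
    have xu := lt_le_trans xa au; have xv := lt_le_trans xa av.
    by rewrite -mulrNN -invrN divr_gt0// opprB subr_gt0 phi_lt.
  have vx := le_lt_trans vb bx; have ux := le_lt_trans ub bx.
  by rewrite divr_gt0// subr_gt0 phi_lt.
have sb := le_trans st tb; have at_ := le_trans as_ st.
pose g u := ln ((phi x - phi u) / (phi x - phi t)).
have dg u : a <= u -> u <= b ->
    is_derive u 1 g (- (al x / (phi x - phi u) - be)).
  move=> au ub.
  pose c := (phi x - phi t)^-1.
  have dr : is_derive u 1 (c \*: (cst (phi x) - phi)) (c *: (0 - dphi u)).
    exact: is_deriveZ.
  have ruE : (c \*: (cst (phi x) - phi)) u = (phi x - phi u) / (phi x - phi t).
    by rewrite mulrC.
  have dl : is_derive ((c \*: (cst (phi x) - phi)) u) 1 (@ln R)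
      ((c \*: (cst (phi x) - phi)) u)^-1.
    by apply: is_derive1_ln; rewrite ruE r0.
  have -> : g = @ln R \o (c \*: (cst (phi x) - phi)).
    by apply/funext => v; rewrite /g /= mulrC.
  apply: is_derive_eq (is_derive1_comp dl dr) _.
  rewrite ruE sub0r /c (dphiE x u) /GRing.scale /=.
  by field; rewrite !phi_neq.
have [||u uP gE] := @MVT_segment _ g (fun u => - (al x / (phi x - phi u) - be)) _ _ st.
- move=> u; rewrite in_itv/= => /andP[su ut].
  by apply: dg; [exact: le_trans (ltW su)|exact: le_trans (ltW ut) tb].
- apply: continuous_in_subspaceT => u; rewrite inE/= in_itv/= => /andP[su ut].
  apply: differentiable_continuous; apply/derivable1_diffP.
  by have [] := dg u (le_trans as_ su) (le_trans ut tb).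
move: uP; rewrite in_itv/= => /andP[su ut].
have au := le_trans as_ su; have ub := le_trans ut tb.
have gt0 : g t = 0 by rewrite /g divff ?ln1// phi_neq.
have -> : ln ((phi x - phi s) / (phi x - phi t)) =
    (al x / (phi x - phi u) - be) * (t - s).
  by rewrite -/(g s); move: gE; rewrite gt0 => gE; lra.
by rewrite !ler_wpM2r ?subr_ge0// lerD2r ler_wpM2l// C_le.
Qed.

Lemma cauchy_kernel_id (R : realType) (a b : R) :
  cauchy_kernel a b idfun (fun=> 1) 0.
Proof.
apply: (@cauchy_kernel_of_derivative _ _ _ _ (fun=> 1) _ _ 1) => //.
by move=> x s; rewrite mul0r subr0.
Qed.

Lemma cauchy_kernel_exp (R : realType) (a b l : R) : 0 < l ->
  cauchy_kernel a b (fun s => expR (l * s)) (fun s => l * expR (l * s)) l.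
Proof.
move=> l0.
apply: (@cauchy_kernel_of_derivative _ _ _ _ (fun s => l * expR (l * s)) _ _
  (l * expR (l * b))).
- by move=> s t st; rewrite ltr_expR ltr_pM2l.
- move=> s; have d1 : is_derive s 1 (l \*: (idfun : R -> R)) (l *: 1).
    exact: is_deriveZ.
  apply: is_derive_eq (is_derive1_comp (is_derive_expR _) d1) _.
  by rewrite /GRing.scale /= mulr1 mulrC.
- by move=> s /andP[_ sb]; rewrite ler_pM2l// ler_expR ler_pM2l.
- by move=> x; rewrite mulr_ge0 ?expR_ge0// ltW.
- by move=> x s; ring.
Qed.

Section abs_charge.
Variables (R : realType) (a b : R) (phi al : R -> R) (be : R).
Hypotheses (a0 : a < 0) (b0 : 0 < b) (ker : cauchy_kernel a b phi al be).

(** The half diagram of [|s|] is the positive part of s, so its measure is Lebesgue measure on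
    [0, b]. The logarithmic sum telescopes to the same value on every grid, and the grid error tends
    to 0. *)
Lemma Rintegral_abs_diagram x : ~~ (a <= x <= b) ->
  \int[lebesgue_stieltjes_measure (half_diagram (abs_diagram R))]_(s in `[a, b])
    (al x / (phi x - phi s) - be) =
  ln ((phi x - phi 0) / (phi x - phi b)).
Proof.
move=> xab; have ab : a < b by exact: lt_trans b0.
have [l Hl] := log_sum_charge ab ker xab.
set I := LHS; set J := RHS.
have zab : a <= 0 <= b by rewrite !ltW.
have bab : a <= b <= b by rewrite lexx ltW.
have absE s : half_diagram (abs_diagram R) s = Num.max s 0.
  rewrite /half_diagram /=; have [s0|s0] := leP s 0.
    by rewrite ler0_norm//; lra.
  by rewrite gtr0_norm//; lra.
have IJ n : `|I - J| <= l * ((b - a) / n.+1%:R).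
  pose t i := grid a b n i.
  (* [c i, t i.+1] is the part of the cell in the positive half-line, reduced to the right end if
     the cell lies to the left of 0. *)
  pose c i := t i.+1 - (Num.max (t i.+1) 0 - Num.max (t i) 0).
  have -> : J = \sum_(i < n.+1)
      ln ((phi x - phi (c i)) / (phi x - phi (t i.+1))).
    pose K i := ln ((phi x - phi (Num.max (t i) 0)) / (phi x - phi b)).
    have := telescope_sumr (fun i => - K i) (leq0n n.+1).
    have K0 : K 0%N = J by rewrite /K /t grid_start max_r ?ltW.
    have Kn : K n.+1 = 0.
      by rewrite /K /t grid_end max_l ?ltW// divff ?ln1// (kernel_neq ker xab).
    rewrite big_mkord K0 Kn opprK oppr0 add0r => <-; apply: eq_bigr => i _.
    rewrite opprK addrC.
    have ti : t i < t i.+1 by exact: grid_ltS.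
    have tab := grid_itv ab (ltnW (ltn_ord i)).
    have tab1 := grid_itv ab (ltn_ord i).
    have lnB u v : a <= u <= b -> a <= v <= b ->
        ln ((phi x - phi u) / (phi x - phi b)) -
        ln ((phi x - phi v) / (phi x - phi b)) =
        ln ((phi x - phi u) / (phi x - phi v)).
      move=> uab vab; rewrite -ln_div ?posrE ?(kernel_ratio_gt0 ker xab)//.
      by congr ln; field; rewrite !(kernel_neq ker xab).
    rewrite /K /c -!/(t _); have [t0|t0] := leP (t i.+1) 0.
      rewrite max_r ?(le_trans (ltW ti))// !subrr subr0.
      by rewrite divff ?ln1// (kernel_neq ker xab).
    have [t0'|t0'] := leP (t i) 0.
      by rewrite subr0 subrr lnB.
    by rewrite subKr lnB.
  apply: (Hl n (abs_diagram R) c (fun i => t i.+1)) => i _.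
  rewrite !absE -!/(t _).
  have ti : t i < t i.+1 by exact: grid_ltS.
  rewrite /c; case: (leP (t i.+1) 0) => ?; case: (leP (t i) 0) => ?;
    by split; lra.
apply/eqP; rewrite -subr_eq0 -normr_le0.
apply: (@cvgr_to_ge nat \oo _ _ (fun n => l * ((b - a) / n.+1%:R))).
  exact: grid_step_cvg0.
by apply: nearW => n; exact: IJ.
Qed.

End abs_charge.

(** * The correspondence *)

Lemma prob_measures_setI (R : realType) (a b : R)
    (mu : probability (measurableTypeR R) R) (A : set R) :
  prob_measures a b mu -> measurable A -> mu A = mu (A `&` `[a, b]).
Proof.
move=> muab mA.
have muC : mu (~` `[a, b]%classic) = 0%E.
  by rewrite probability_setC// [X in (_ - X)%E]muab subee.
have AD : mu (A `\` `[a, b]%classic) = 0%E.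
  apply/eqP; rewrite eq_le measure_ge0 andbT -muC.
  apply: le_measure; rewrite ?inE//; first exact: measurableD.
    exact: measurableC.
transitivity (mu (A `&` `[a, b]) + mu (A `\` `[a, b]%classic))%E; last first.
  by rewrite [X in (_ + X)%E]AD adde0.
rewrite -measureU ?setUIDK//; [exact: measurableI|exact: measurableD|].
by rewrite setDE setIACA setICr setI0.
Qed.

Lemma prob_measures_unique (R : realType) (a b : R)
    (mu nu : probability (measurableTypeR R) R) :
  prob_measures a b mu -> prob_measures a b nu ->
  (forall t, a <= t <= b -> mu `[a, t]%classic = nu `[a, t]%classic) ->
  forall A : set R, measurable A -> nu A = mu A.
Proof.
move=> muab nuab mu_nu A mA.
have muNy u : mu `]-oo, u]%classic = nu `]-oo, u]%classic.
  rewrite (prob_measures_setI muab)// (prob_measures_setI nuab)//.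
  have -> : `]-oo, u] `&` `[a, b] = `[a, (Num.min u b)]%classic :> set R.
    apply/seteqP; split => s /=; rewrite !in_itv/= le_min.
      by move=> [-> /andP[-> ->]].
    by move=> /andP[-> /andP[-> ->]].
  have [am|ma] := leP a (Num.min u b).
    by apply: mu_nu; rewrite am ge_min lexx orbT.
  by rewrite set_itv_ge ?measure0// bnd_simp -ltNge.
(* [nu] is the Stieltjes measure of its own distribution function, so agreement with [mu] on
   half-open intervals suffices. *)
rewrite -(lebesgue_stieltjes_cdf_id nu mA).
apply: lebesgue_stieltjes_measure_unique => // _ [[s t] /= _ <-].
rewrite [LHS](lebesgue_stieltjes_cdf_id nu)//.
have D (m : probability (measurableTypeR R) R) : m `]s, t]%classic =
    (m `]-oo, t]%classic - m `]-oo, (Num.min t s)]%classic)%E.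
  have -> : `]s, t]%classic = `]-oo, t] `\` `]-oo, s] :> set R.
    by rewrite -[RHS]setCK setCD setCitvl setUC -[LHS]setCK setCitv.
  rewrite measureD//; last by rewrite -ge0_fin_numE// fin_num_measure.
  congr (_ - m _)%E; apply/seteqP; split => u /=; rewrite !in_itv/= le_min.
    by move=> [-> ->].
  by move=> /andP[].
by apply: etrans (D nu) _; apply: etrans _ (esym (D mu)); rewrite !muNy.
Qed.

(** Membership in [diagrams] prescribes values strictly outside [a, b]; the Lipschitz bound carries
    them to the end points. *)
Lemma diagram_endpoints (R : realType) (a b : R) (w : continual_diagram R) :
  diagrams a b w ->
  exists2 s0, a <= s0 <= b &
    [/\ w a = s0 - a, w b = b - s0 &
     forall s, ~~ (a <= s <= b) -> w s = `|s - s0|].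
Proof.
move=> [s0 [/andP[as0 s0b] wE]]; exists s0; first by rewrite as0.
have close (u v : R) : (forall e, 0 < e -> `|u - v| <= e) -> u = v.
  move=> uv; apply/eqP; rewrite -subr_eq0 -normr_le0; apply/ler_addgt0Pr => e e0.
  by rewrite add0r uv.
split => //.
- apply: close => e e0; have e2 : 0 < e / 2 by rewrite divr_gt0.
  have sN : ~~ (a <= a - e / 2 <= b) by rewrite negb_and -ltNge; apply/orP; left; lra.
  have := diagram_lipschitz w a (a - e / 2); rewrite subKr (gtr0_norm e2) (wE _ sN).
  have -> : `|a - e / 2 - s0| = s0 - a + e / 2 by rewrite ltr0_norm; lra.
  by rewrite !ler_norml => /andP[? ?]; apply/andP; split; lra.
- apply: close => e e0; have e2 : 0 < e / 2 by rewrite divr_gt0.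
  have sN : ~~ (a <= b + e / 2 <= b).
    by rewrite negb_and -!ltNge; apply/orP; right; lra.
  have := diagram_lipschitz w b (b + e / 2).
  rewrite opprD addrA subrr sub0r normrN (gtr0_norm e2) (wE _ sN).
  have -> : `|b + e / 2 - s0| = b - s0 + e / 2 by rewrite ger0_norm; lra.
  by rewrite !ler_norml => /andP[? ?]; apply/andP; split; lra.
Qed.

(** The increment of the half diagram over [a, b] is b - s0, so the increments determine the centre,
    and with it the value at a. *)
Lemma diagrams_unique (R : realType) (a b : R) (w v : continual_diagram R) :
  a <= b -> diagrams a b w -> diagrams a b v ->
  (forall t, a <= t <= b -> half_diagram w t - half_diagram w a =
                            half_diagram v t - half_diagram v a) ->
  forall s, v s = w s.
Proof.
move=> ab /diagram_endpoints[s0 _ [wa wb wE]].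
move=> /diagram_endpoints[s1 _ [va vb vE]] wv s.
have := wv b; rewrite lexx ab /half_diagram wa wb va vb => /(_ isT) s01.
have {}s01 : s0 = s1 by lra.
have [sab|sab] := boolP (a <= s <= b); last by rewrite wE// vE// s01.
by have := wv s sab; rewrite /half_diagram wa va s01; lra.
Qed.

(** * The correspondence for one kernel *)

Section kernel_correspondence.
Variables (R : realType) (a b : R) (phi al : R -> R) (be : R).
Hypotheses (ab : a < b) (ker : cauchy_kernel a b phi al be).
Hypothesis phi_unbounded : forall M, exists2 x, b < x & M < phi x.
Hypothesis al_neq0 : forall x, al x != 0.
(** When [be] is nonzero, the exponent mixes the Cauchy transform with [be] times the mass of the
    half diagram. Points x to the left of [a] where the first term is uniformly small isolate the
    second. *)
Hypothesis be_mass : be = 0 \/ forall e : R, 0 < e ->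
  exists2 x, x < a & forall s, a <= s <= b -> `|al x / (phi x - phi s)| <= e.

Let I (w : continual_diagram R) x :=
  \int[lebesgue_stieltjes_measure (half_diagram w)]_(s in `[a, b])
    (al x / (phi x - phi s) - be).

Let C (w : continual_diagram R) x :=
  \int[lebesgue_stieltjes_measure (half_diagram w)]_(s in `[a, b])
    (phi x - phi s)^-1.

Let mass (w : continual_diagram R) := half_diagram w b - half_diagram w a.

Let nu_fin (w : continual_diagram R) :
  (lebesgue_stieltjes_measure (half_diagram w) `[a, b]%classic < +oo)%E.
Proof. by rewrite half_diagram_itvcc ?ltW// ltry. Qed.

Let integrable_cauchy w x : ~~ (a <= x <= b) ->
  (lebesgue_stieltjes_measure (half_diagram w)).-integrable `[a, b]
    (EFin \o (fun s => (phi x - phi s)^-1)).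
Proof.
move=> xab; have [l Cl] := cauchy_nondecreasing_lipschitz ab ker xab.
exact: nondecreasing_integrable ab (nondecreasing_lipschitz_homo Cl) (nu_fin w).
Qed.

Let integrable_log w x : ~~ (a <= x <= b) ->
  (lebesgue_stieltjes_measure (half_diagram w)).-integrable `[a, b]
    (EFin \o (fun s => al x / (phi x - phi s))).
Proof.
move=> xab; have [l Cl] := cauchy_nondecreasing_lipschitz ab ker xab.
apply: (nondecreasing_integrable ab _ (nu_fin w)) => s t sab tab st.
rewrite ler_wpM2l ?(kernel_ge0 ker)//.
exact: (nondecreasing_lipschitz_homo Cl).
Qed.

Let integrable_cst w (c : R) :
  (lebesgue_stieltjes_measure (half_diagram w)).-integrable `[a, b]
    (EFin \o (fun=> c)).
Proof.
by apply: (bounded_measurable_integrable (nu_fin w) (M := `|c|)).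
Qed.

Let cst_mass w c :
  \int[lebesgue_stieltjes_measure (half_diagram w)]_(s in `[a, b]) c =
  c * mass w.
Proof.
by rewrite Rintegral_cst// [X in fine X]half_diagram_itvcc// ltW.
Qed.

Let alC w x : ~~ (a <= x <= b) -> al x * C w x =
  \int[lebesgue_stieltjes_measure (half_diagram w)]_(s in `[a, b])
    (al x / (phi x - phi s)).
Proof. by move=> xab; rewrite RintegralZl//; exact: integrable_cauchy. Qed.

Let IE w x : ~~ (a <= x <= b) -> I w x = al x * C w x - be * mass w.
Proof.
move=> xab; rewrite /I RintegralB//; [|exact: integrable_log|exact: integrable_cst].
by rewrite alC// cst_mass.
Qed.

Let alC_bound w x e : ~~ (a <= x <= b) ->
  (forall s, a <= s <= b -> `|al x / (phi x - phi s)| <= e) ->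
  `|al x * C w x| <= e * mass w.
Proof.
move=> xab xe; rewrite alC//.
apply: le_trans (le_normr_Rintegral _ (integrable_log w xab)) _ => //.
rewrite -cst_mass; apply: le_Rintegral => //.
- exact: integrable_norm (integrable_log w xab).
- exact: integrable_cst.
Qed.

(** By [IE], the difference of the two sides equals that of the terms [al x * C w x] and
    [al x * C v x]. Both masses are at most b - a, so a kernel bound of e / (2 (b - a)) makes the
    difference at most e. *)
Let mass_eq w v : (forall x, ~~ (a <= x <= b) -> I w x = I v x) ->
  be * mass w = be * mass v.
Proof.
move=> wv; case: be_mass => [->|small]; first by rewrite !mul0r.
have massP u : 0 <= mass u <= b - a by exact/half_diagram_lipschitz/ltW.
have ba0 : 0 < (b - a) *+ 2 by rewrite pmulrn_lgt0// subr_gt0.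
apply/eqP; rewrite -subr_eq0 -normr_le0; apply/ler_addgt0Pr => e e0.
have [x xa xe] := small (e / ((b - a) *+ 2)) (divr_gt0 e0 ba0).
have xab : ~~ (a <= x <= b) by rewrite negb_and -ltNge xa.
have E : be * mass w - be * mass v = al x * C w x - al x * C v x.
  have aux (p r s t : R) : p - r = s - t -> r - t = p - s.
    by move=> prst; lra.
  apply: aux; apply: etrans (esym (@IE w x xab)) _.
  exact: etrans (wv x xab) (@IE v x xab).
rewrite E add0r; apply: le_trans (ler_normB _ _) _.
apply: le_trans
  (lerD (@alC_bound w x _ xab xe) (@alC_bound v x _ xab xe)) _.
rewrite -mulrDr -ler_pdivlMl ?divr_gt0// invf_div divfK ?gt_eqF//.
have /andP[_ h1] := massP w; have /andP[_ h2] := massP v.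
by rewrite mulr2n lerD.
Qed.

Lemma diagram_transform_inj w v : diagrams a b w -> diagrams a b v ->
  (forall x, ~~ (a <= x <= b) -> I w x = I v x) -> forall s, v s = w s.
Proof.
move=> wab vab wv; apply: (diagrams_unique (ltW ab) wab vab) => t tab.
have /andP[at_ tb] := tab; apply: EFin_inj.
rewrite -!half_diagram_itvcc//.
apply: (stieltjes_transform_inj ab (kernel_lt ker) phi_unbounded (nu_fin w)
  (nu_fin v) _ tab) => x bx.
have xab : ~~ (a <= x <= b) by rewrite negb_and -!ltNge bx orbT.
under eq_Rintegral do rewrite mul1r.
under [RHS]eq_Rintegral do rewrite mul1r.
apply: (mulfI (al_neq0 x)); rewrite -/(C w x) -/(C v x).
apply: (@addIr _ (- (be * mass v))); rewrite -{1}(mass_eq wv).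
apply: etrans (esym (@IE w x xab)) _.
exact: etrans (wv x xab) (@IE v x xab).
Qed.

Lemma measure_transform_inj (mu nu : probability (measurableTypeR R) R) :
  prob_measures a b mu -> prob_measures a b nu ->
  (forall x, ~~ (a <= x <= b) ->
     \int[mu]_(s in `[a, b]) (phi x - phi s)^-1 =
     \int[nu]_(s in `[a, b]) (phi x - phi s)^-1) ->
  forall A : set R, measurable A -> nu A = mu A.
Proof.
move=> muab nuab mn; apply: (prob_measures_unique muab nuab) => t tab.
have fin (m : probability (measurableTypeR R) R) : prob_measures a b m ->
    (m `[a, b]%classic < +oo)%E.
  by move=> mab; rewrite [X in (X < _)%E]mab ltry.
apply: (stieltjes_transform_inj ab (kernel_lt ker) phi_unbounded (fin _ muab)
  (fin _ nuab) _ tab) => x bx.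
have xab : ~~ (a <= x <= b) by rewrite negb_and -!ltNge bx orbT.
under eq_Rintegral do rewrite mul1r.
by under [RHS]eq_Rintegral do rewrite mul1r; exact: mn.
Qed.

Lemma kernel_correspondence
    (corr : continual_diagram R -> probability (measurableTypeR R) R -> Prop) :
  (forall w mu, corr w mu <-> forall x, ~~ (a <= x <= b) ->
     \int[mu]_(s in `[a, b]) (phi x - phi s)^-1 =
     (phi x - phi b)^-1 * expR (- I w x)) ->
  (forall w : continual_diagram R, diagrams a b w ->
     exists mu : probability (measurableTypeR R) R,
       [/\ prob_measures a b mu, corr w mu &
           forall nu : probability (measurableTypeR R) R,
             prob_measures a b nu -> corr w nu ->
             forall A : set R, measurable A -> nu A = mu A])
  /\
  (forall mu : probability (measurableTypeR R) R, prob_measures a b mu ->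
     exists w : continual_diagram R,
       [/\ diagrams a b w, corr w mu &
           forall v : continual_diagram R,
             diagrams a b v -> corr v mu -> forall s : R, v s = w s]).
Proof.
move=> corrE; split.
  move=> w wab; have [mu muab muE] := exists_measure_of_diagram ab ker w.
  exists mu; split => //; first exact/corrE.
  move=> nu nuab /corrE nuE; apply: (measure_transform_inj muab nuab) => x xab.
  exact: etrans (muE x xab) (esym (nuE x xab)).
move=> mu muab; have [w wab wE] := exists_diagram_of_measure ab ker muab.
exists w; split => //; first exact/corrE.
move=> v vab /corrE vE; apply: (diagram_transform_inj wab vab) => x xab.
have b0 : (phi x - phi b)^-1 != 0.
  by rewrite invr_eq0 (kernel_neq ker xab)// lexx ltW.
apply/oppr_inj/expR_inj/(mulfI b0).
exact: etrans (esym (wE x xab)) (vE x xab).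
Qed.

End kernel_correspondence.

Theorem theorem4p14 (R : realType) (a b q : R)
    (ha : a < 0) (hb : 0 < b) (hq : 0 < q <= 1) :
  (forall w : continual_diagram R, diagrams a b w ->
     exists mu : probability (measurableTypeR R) R,
       [/\ prob_measures a b mu,
           corresponds a b q w mu &
           forall nu : probability (measurableTypeR R) R,
             prob_measures a b nu -> corresponds a b q w nu ->
             forall A : set R, measurable A -> nu A = mu A])
  /\
  (forall mu : probability (measurableTypeR R) R, prob_measures a b mu ->
     exists w : continual_diagram R,
       [/\ diagrams a b w,
           corresponds a b q w mu &
           forall v : continual_diagram R,
             diagrams a b v -> corresponds a b q v mu ->
             forall s : R, v s = w s]).
Proof.
have ab : a < b by exact: lt_trans hb.
have zab : a <= 0 <= b by rewrite !ltW.
have bab : a <= b <= b by rewrite lexx ltW.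
have [q1|qn1] := eqVneq q 1.
  have ker := cauchy_kernel_id a b.
  apply: (kernel_correspondence ab ker) => [M||| w mu].
  - exists (Num.max M b + 1); first by rewrite ltr_pwDr// le_max lexx orbT.
    by rewrite /= ltr_pwDr// le_max lexx.
  - by move=> x; exact: oner_neq0.
  - by left.
  (* The [|s|] part of the charge contributes the factor x / (x - b), which turns the prefactor 1 /
     x into 1 / (x - b); x is nonzero because 0 lies in [a, b]. *)
  have RE x : ~~ (a <= x <= b) -> Rdiagram a b w q x = (x - b)^-1 * expR (-
      \int[lebesgue_stieltjes_measure (half_diagram w)]_(s in `[a, b])
        (1 / (x - s) - 0)).
    move=> xab; have x0 : x != 0 by apply: contraNneq xab => ->.
    have xb : x - b != 0 by exact: (kernel_neq ker xab bab).
    rewrite /Rdiagram q1 eqxx /charge_integral.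
    rewrite [X in - (X - _)](_ : _ = \int[lebesgue_stieltjes_measure
      (half_diagram w)]_(s in `[a, b]) (1 / (x - s) - 0)); last first.
      by apply: eq_Rintegral => s _; rewrite div1r subr0.
    rewrite [X in - (_ - X)](_ : _ = ln ((x - 0) / (x - b))); last first.
      rewrite -(Rintegral_abs_diagram ha hb ker xab).
      by apply: eq_Rintegral => s _; rewrite div1r subr0.
    rewrite opprB expRD lnK; last first.
      by rewrite posrE; exact: (kernel_ratio_gt0 ker xab zab bab).
    by rewrite subr0; field; rewrite x0 xb.
  have ME x : Rmeasure a b mu q x = \int[mu]_(s in `[a, b]) (x - s)^-1.
    by rewrite /Rmeasure q1 eqxx.
  by split=> h x xab; have := h x xab; rewrite ME RE.
have /andP[q0 qle1] := hq; have ql1 : q < 1 by rewrite lt_neqAle qn1.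
pose L := ln q^-1.
have LE : ln q = - L by rewrite /L lnV ?posrE// opprK.
have L0 : 0 < L by rewrite /L ln_gt0// invf_gt1.
have qE y : q `^ y = expR (- (L * y)).
  by rewrite /powR gt_eqF// LE mulrN mulrC.
have ker := cauchy_kernel_exp a b L0.
apply: (kernel_correspondence ab ker) => [M||| w mu].
- exists (Num.max (M / L) b + 1).
    by rewrite ltr_pwDr// le_max lexx orbT.
  apply: lt_le_trans (expR_ge1Dx _); rewrite ltr_pwDl// mulrC -ler_pdivrMr//.
  by rewrite (@le_trans _ _ (Num.max (M / L) b))// ?lerDl// le_max lexx.
- by move=> x; rewrite mulf_neq0 ?gt_eqF ?expR_gt0.
- right => e e0; have ea0 := expR_gt0 (L * a).
  have Le0 : 0 < L + e by exact: addr_gt0.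
  (* The value of phi x for which the kernel at s = a has absolute value exactly [e], the solution
     of L z = e (phi a - z); for s > a the kernel is smaller. *)
  pose z := e * expR (L * a) / (L + e).
  have z0 : 0 < z by rewrite divr_gt0// mulr_gt0.
  have zE : expR (L * (ln z / L)) = z.
    by rewrite mulrCA divff ?gt_eqF// mulr1 lnK// posrE.
  have zLe : L * z = e * (expR (L * a) - z).
    by rewrite /z; field; rewrite gt_eqF.
  have za : z < expR (L * a).
    by rewrite -subr_gt0 -(pmulr_rgt0 _ e0) -zLe mulr_gt0.
  exists (ln z / L); first by rewrite -(ltr_pM2l L0) -ltr_expR zE.
  move=> s /andP[as_ _]; rewrite zE.
  have sa : expR (L * a) <= expR (L * s) by rewrite ler_expR ler_pM2l.
  have sz : 0 < expR (L * s) - z by rewrite subr_gt0 (lt_le_trans za).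
  rewrite normf_div distrC (gtr0_norm sz) (gtr0_norm (mulr_gt0 L0 z0)).
  by rewrite ler_pdivrMr// zLe ler_pM2l// lerD2r.
have qB x s : 1 - q `^ (x - s) = (expR (L * x) - expR (L * s)) / expR (L * x).
  rewrite qE mulrBr opprB expRD expRN; field.
  by rewrite gt_eqF ?expR_gt0.
have ME x : ~~ (a <= x <= b) -> Rmeasure a b mu q x = (1 - q) * expR (L * x) *
    \int[mu]_(s in `[a, b]) (expR (L * x) - expR (L * s))^-1.
  move=> xab; rewrite /Rmeasure (negbTE qn1) -mulrA; congr (_ * _).
  have mufin : (mu `[a, b]%classic < +oo)%E.
    exact: le_lt_trans (probability_le1 _ _) (ltry _).
  have [l Cl] := cauchy_nondecreasing_lipschitz ab ker xab.
  have Cint :=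
    nondecreasing_integrable ab (nondecreasing_lipschitz_homo Cl) mufin.
  rewrite -[RHS]RintegralZl//; apply: eq_Rintegral => s _.
  by rewrite qB invf_div.
(* Here q^(x - s) = phi s / phi x, so [L] times the kernel is L phi x / (phi x - phi s) - L. The
   prefactor is (1 - q) phi x / (phi x - phi 0), whose denominator cancels against the [|s|] part of
   the charge. *)
have RE x : ~~ (a <= x <= b) -> Rdiagram a b w q x =
    (1 - q) * expR (L * x) * ((expR (L * x) - expR (L * b))^-1 * expR (-
    \int[lebesgue_stieltjes_measure (half_diagram w)]_(s in `[a, b])
      (L * expR (L * x) / (expR (L * x) - expR (L * s)) - L))).
  move=> xab; have zneq s := kernel_neq ker xab (s := s).
  have ez : expR (L * x) != 0 by rewrite gt_eqF ?expR_gt0.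
  have LI (v : continual_diagram R) :
      L * \int[lebesgue_stieltjes_measure (half_diagram v)]_(s in `[a, b])
        (q `^ (x - s) / (1 - q `^ (x - s))) =
      \int[lebesgue_stieltjes_measure (half_diagram v)]_(s in `[a, b])
        (L * expR (L * x) / (expR (L * x) - expR (L * s)) - L).
    have [l kl] := log_kernel_nondecreasing_lipschitz ab ker xab.
    have vfin : (lebesgue_stieltjes_measure (half_diagram v)
        `[a, b]%classic < +oo)%E by rewrite half_diagram_itvcc ?ltW// ltry.
    have kint :=
      nondecreasing_integrable ab (nondecreasing_lipschitz_homo kl) vfin.
    apply: (mulfI (_ : L^-1 != 0)); first by rewrite invr_eq0 gt_eqF.
    rewrite mulKf ?gt_eqF// -[RHS]RintegralZl//.
    apply: eq_Rintegral => s; rewrite inE/= in_itv/= => sab.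
    rewrite qB qE mulrBr opprB expRD expRN.
    by field; rewrite zneq// gt_eqF// ez.
  rewrite /Rdiagram (negbTE qn1) /charge_integral mulrBr !LI.
  rewrite (Rintegral_abs_diagram ha hb ker xab) opprB expRD lnK; last first.
    by rewrite posrE (kernel_ratio_gt0 ker xab).
  have := zneq _ zab; rewrite mulr0 expR0 => z1; have zb := zneq _ bab.
  rewrite -[x in q `^ x]subr0 qB mulr0 expR0.
  by field; rewrite z1 zb ez.
(* The factor common to both transforms; cancelling it leaves the equation between Cauchy
   transforms. *)
have c0 x : (1 - q) * expR (L * x) != 0.
  by rewrite mulf_neq0 ?gt_eqF ?expR_gt0// subr_gt0.
split=> h x xab; first by apply: (mulfI (c0 x)); rewrite -ME// -RE// h.
by rewrite ME// RE// h.
Qed.
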